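(* Consider the PARID model with parameters $\delta=0$ and $X$, where $X$ has the power-law distribution of exponent $2$, i.e. $\mathbb{P}[X=i]=\beta(2)\, i^{-2}$, $i\in\{1,2,\dots\}$. For $k\ge 1$ let $r_k(t)$ be the proportion of vertices of degree $k$ after step $t$. Then for any $k\ge 1$, $r_k(t)\to b_k$ in probability as $t\to\infty$, where $$b_k=\frac{2\beta(2)}{k(k+1)(k+2)}\sum_{i=1}^{k}\left(1+\frac1i\right).$$
   Context: $\beta(2)=\bigl(\sum_{i\ge1} i^{-2}\bigr)^{-1}$ is the normalising constant. PARID model (Preferential Attachment with Random Initial Degrees) with $\delta=0$ and a positive-integer-valued random variable $X$: let $X_1,X_2,\dots$ be independent copies of $X$ and $\Lambda(t)=\sum_{i=1}^t X_i$. In step $1$ two vertices $v_0,v_1$ are created and joined by $X_1$ (parallel) edges. In each step $t\ge 2$ a new vertex $v_t$ is added together with $X_t$ edges; each of these $X_t$ edges is generated independently (given the multigraph after step $t-1$ and $X_t$) by choosing a vertex $v_i$, $0\le i\le t-1$, with probability $\frac{d_i(t-1)}{2\Lambda(t-1)}$, where $d_i(t-1)$ is the degree of $v_i$ after step $t-1$, and adding the edge $\{v_i,v_t\}$ to the multigraph. (Edges added in the same step do not influence each other's selection probabilities, and there are no loops.) $R_k(t)$ is the number of vertices of degree $k$ after step $t$, and $r_k(t)=R_k(t)/(t+1)$. *)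

(* Defs.v *)
From HB Require Import structures.
From mathcomp Require Import all_boot all_order all_algebra.
From mathcomp Require Import all_classical all_reals all_analysis.

Set Implicit Arguments.
Unset Strict Implicit.
Unset Printing Implicit Defensive.

Import Order.TTheory GRing.Theory Num.Theory.
Import numFieldNormedType.Exports.

Local Open Scope classical_set_scope.
Local Open Scope ring_scope.

Definition beta2 (R : realType) : R :=
  (\big[+%R/0]_(1 <= i <oo) (i%:R ^- 2 : R))^-1.

Definition power_law2 d (T : measurableType d) (R : realType)
    (P : probability T R) (X : {RV P >-> nat}) : Prop :=
  forall i : nat, (0 < i)%N ->
    P (X @^-1` [set i]) = (beta2 R * i%:R ^- 2)%:E.

Definition mutually_independent d (T : measurableType d) (R : realType)
    (P : probability T R) (X : nat -> {RV P >-> nat}) : Prop :=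
  forall (s : seq nat) (A : nat -> set nat),
    uniq s -> (forall i, measurable (A i)) ->
    P [set w | forall i, i \in s -> A i (X i w)] =
      (\prod_(i <- s) P (X i @^-1` A i))%E.

Definition cvg_in_probability d (T : measurableType d) (R : realType)
    (P : probability T R) (Y : nat -> T -> R) (l : R) : Prop :=
  forall eps : R, 0 < eps ->
    P [set w | eps < `|Y n w - l|] @[n --> \oo] --> 0%E.

(* A multigraph on the vertices v_0, v_1, ... is the list of its edges;
   the order of the list is immaterial, so that two lists describe the same
   multigraph when they are related by perm_eq. *)
Definition multigraph := seq (nat * nat).

Definition degree (g : multigraph) (i : nat) : nat :=
  (count (fun e => e.1 == i) g + count (fun e => e.2 == i) g)%N.

(* The number of edges [size g] plays the role of Lambda(t). *)
Definition attach_prob (R : realType) (g : multigraph) (i : nat) : R :=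
  (degree g i)%:R / (2 * (size g)%:R).

(* [pa_graph x c t] is the multigraph after step t, where x s is the number of
   edges added in step s and v_(c s j) is the older endpoint of the j-th of
   them (0 <= j < x s).  The values x 0, c 0 and c 1 are not used; there is no
   step 0. *)
Fixpoint pa_graph (x : nat -> nat) (c : nat -> nat -> nat) (t : nat) :
    multigraph :=
  match t with
  | 0 => [::]
  | 1 => nseq (x 1%N) (0%N, 1%N)
  | s.+1 => pa_graph x c s ++ [seq (c t j, t) | j <- iota 0 (x t)]
  end.

Section Parid.
Context d (T : measurableType d) (R : realType) (P : probability T R).
Implicit Types (X : nat -> {RV P >-> nat}) (C : nat -> nat -> {RV P >-> nat}).

Definition parid_graph X C (t : nat) (w : T) : multigraph :=
  pa_graph (fun s => X s w) (fun s j => C s j w) t.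

(* PARID model with delta = 0, where mu is the law of the initial degrees.
   The endpoints C t j with j >= X t are not used and are left unconstrained.
   The last two fields describe step t.+1 >= 2: its number of edges is
   independent of the current multigraph and, conditionally on that multigraph
   being g and on there being n edges to add, the n endpoints are i.i.d. with
   law attach_prob g. Conditioning is written in product form, so that nothing
   is divided by the probability of a null event. *)
Record parid (mu : probability nat R) X C : Prop := {
  parid_pos : mu [set 0%N] = 0%E;
  parid_law : forall t, (0 < t)%N ->
    forall A : set nat, measurable A -> P (X t @^-1` A) = mu A;
  parid_indep : mutually_independent (fun t => X t.+1);
  parid_fresh : forall t, (0 < t)%N -> forall (g : multigraph) (n : nat),
    P ([set w | perm_eq (parid_graph X C t w) g] `&` X t.+1 @^-1` [set n]) =
      (P [set w | perm_eq (parid_graph X C t w) g]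
       * P (X t.+1 @^-1` [set n]))%E;
  parid_attach : forall t, (0 < t)%N ->
    forall (g : multigraph) (n : nat) (i : nat -> nat),
    (forall j, (j < n)%N -> (i j <= t)%N) ->
    P ([set w | perm_eq (parid_graph X C t w) g] `&` X t.+1 @^-1` [set n]
       `&` [set w | forall j, (j < n)%N -> C t.+1 j w = i j]) =
      (P ([set w | perm_eq (parid_graph X C t w) g] `&` X t.+1 @^-1` [set n])
       * (\prod_(j < n) attach_prob R g (i j))%:E)%E
}.

(* R_k(t) and r_k(t); the vertices after step t are v_0, ..., v_t. *)
Definition num_degree X C (k t : nat) (w : T) : nat :=
  count (fun i => degree (parid_graph X C t w) i == k) (iota 0 t.+1).

Definition prop_degree X C (k t : nat) (w : T) : R :=
  (num_degree X C k t w)%:R / t.+1%:R.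

End Parid.

Definition b_lim (R : realType) (k : nat) : R :=
  2 * beta2 R / (k%:R * (k%:R + 1) * (k%:R + 2))
  * \sum_(1 <= i < k.+1) (1 + i%:R^-1).

(* Main.v *)
Require Import Defs.
From HB Require Import structures.
From mathcomp Require Import all_boot all_order all_algebra.
From mathcomp Require Import all_classical all_reals all_analysis.
From mathcomp Require Import measurable_realfun.
From mathcomp Require Import ring lra zify.

Import Order.TTheory GRing.Theory Num.Theory.
Import numFieldNormedType.Exports.

Set Implicit Arguments.
Unset Strict Implicit.
Unset Printing Implicit Defensive.

Local Open Scope classical_set_scope.
Local Open Scope ring_scope.

(** Write s = t + 1 for the number of vertices, L for the number of edges and
    m(M) = E[min(X, M)] for the truncated mean of the batch size X.

    A batch of n edges reaches a given vertex of degree d about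
    min(n, L) / L * d / 2 times on average, and twice or more with a probability
    of order (min(n, L) / L)^2 ([degree_gain_mean], and for the joint effect on
    two vertices [degree_gain_second_moment]).  Averaged over n, these become
    m(L) / L * d / 2 and O(1 / L), because the tail of X at j is O(1 / j).
    Although X has infinite mean, L is close to t m(t) and m varies slowly
    ([trunc_mean_slow]), so m(L) / L is close to 1 / t: a vertex of degree d is
    still reached at rate d / (2 t), and double hits, of order 1 / L = o(1 / t),
    are negligible.  Hence the limits must satisfy
    (k + 2) b_k = 2 P[X = k] + (k - 1) b_(k-1), which the explicit formula does
    ([b_lim_rec]).

    That L is close to t m(t) is needed in mean for t m(t) / L, since this ratio
    multiplies the drift ([inverse_size_lln]).  Small values of L are excluded
    by truncating the batches at t: the variance of the truncated sum is
    O(t^2), negligible against (t m(t))^2.  Large values are excluded by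
    truncating at K t: the expected number of batches beyond is O(1 / K).

    Convergence is proved in mean square.  Put x_k = R_k / s - b_k.  In the
    conditional mean of the increment of (s x_k)^2 the recurrence cancels the
    constant terms, the term in - k x_k^2 has the good sign, and what remains is
    at most a multiple of s ((k - 1) x_(k-1)^2 + o(1)) ([drift_inequality],
    [deviation_next]).  By induction on k the bracket tends to 0 in mean, so
    summing over the steps gives E[(s x_k)^2] = o(s^2) ([deviation_cvg]); the
    Markov inequality then gives convergence in probability.

    Conditional expectations are avoided: the state space is countable, so an
    inequality between expectations is checked on each event on which the
    current multigraph, taken up to the order of its edges, is given
    ([cells_le], [average_batch], [average_attachment]). *)

(** * Expectations of bounded functions of discrete maps *)

Definition bounded_measurable {d} {T : measurableType d} {R : realType}
    (f : T -> R) : Prop :=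
  measurable_fun setT f /\ exists B, forall w, `|f w| <= B.

Definition discrete_map {d} {T : measurableType d} {I : countType}
    (S : T -> I) : Prop := forall i, measurable (S @^-1` [set i]).

Section DiscreteMaps.
Context {d} {T : measurableType d}.

Lemma discrete_preimage {I : countType} (S : T -> I) (A : set I) :
  discrete_map S -> measurable (S @^-1` A).
Proof.
move=> dS.
rewrite (_ : _ @^-1` _ =
    \bigcup_i (if i \in A then S @^-1` [set i] else set0)); last first.
  apply/seteqP; split=> [w Aw|w [i _]].
    by exists (S w) => //; rewrite mem_set.
by case: ifPn => // /set_mem Ai /= Sw; rewrite -Sw in Ai.
apply: countable_bigcupT_measurable => [|i]; first exact: countableP.
by case: ifP.
Qed.

Lemma discrete_comp {I J : countType} (h : I -> J) (S : T -> I) :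
  discrete_map S -> discrete_map (h \o S).
Proof. by move=> dS i; exact: (discrete_preimage (h @^-1` [set i]) dS). Qed.

Lemma discrete_pair {I J : countType} (S : T -> I) (S' : T -> J) :
  discrete_map S -> discrete_map S' -> discrete_map (fun w => (S w, S' w)).
Proof.
move=> dS dS' [i j].
rewrite (_ : _ @^-1` _ = S @^-1` [set i] `&` S' @^-1` [set j]).
  exact: measurableI.
by apply/seteqP; split=> w /= [-> ->].
Qed.

Lemma discrete_measurable_fun {I : countType} d' (U : measurableType d')
    (f : I -> U) (S : T -> I) (D : set T) :
  discrete_map S -> measurable D -> measurable_fun D (f \o S).
Proof.
by move=> dS mD _ B _; apply: measurableI => //;
  exact: (discrete_preimage (f @^-1` B) dS).
Qed.

Lemma discrete_mfun (X : {mfun T >-> nat}) : discrete_map X.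
Proof.
by move=> i; rewrite -[X in measurable X]setTI;
  exact: measurable_funPT.
Qed.

End DiscreteMaps.

Section BoundedMeasurable.
Context {d} {T : measurableType d} {R : realType}.
Implicit Types f g : T -> R.

Lemma bounded_measurable_comp {I : countType} (S : T -> I) (phi : I -> R) B :
  discrete_map S -> (forall w, `|phi (S w)| <= B) ->
  bounded_measurable (fun w => phi (S w)).
Proof. by move=> dS hB; split; [exact: discrete_measurable_fun|exists B]. Qed.

Lemma bounded_measurable_cst c : bounded_measurable (fun _ : T => c : R).
Proof. by split => //; exists `|c|. Qed.

Lemma bounded_measurableD f g : bounded_measurable f -> bounded_measurable g ->
  bounded_measurable (fun w => f w + g w).
Proof.
move=> [mf [B hB]] [mg [B' hB']]; split; first exact: measurable_funD.
by exists (B + B') => w; rewrite (le_trans (ler_normD _ _))// lerD.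
Qed.

Lemma bounded_measurableM f g : bounded_measurable f -> bounded_measurable g ->
  bounded_measurable (fun w => f w * g w).
Proof.
move=> [mf [B hB]] [mg [B' hB']]; split; first exact: measurable_funM.
by exists (B * B') => w; rewrite normrM ler_pM.
Qed.

Lemma bounded_measurableZ c f : bounded_measurable f ->
  bounded_measurable (fun w => c * f w).
Proof. exact/bounded_measurableM/bounded_measurable_cst. Qed.

Lemma bounded_measurableB f g : bounded_measurable f -> bounded_measurable g ->
  bounded_measurable (fun w => f w - g w).
Proof.
move=> hf /(bounded_measurableZ (-1)) /(bounded_measurableD hf).
by under [X in bounded_measurable X]eq_fun do rewrite mulN1r.
Qed.

Lemma bounded_measurable_sum n (f : 'I_n -> T -> R) :
  (forall i, bounded_measurable (f i)) ->
  bounded_measurable (fun w => \sum_(i < n) f i w).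
Proof.
move=> hf; elim: n f hf => [|n IH] f hf.
  by under eq_fun do rewrite big_ord0; exact: bounded_measurable_cst.
under eq_fun do rewrite big_ord_recr /=.
by apply: bounded_measurableD => //; exact: IH.
Qed.

End BoundedMeasurable.

Section Expectation.
Context {d} {T : measurableType d} {R : realType} (P : probability T R).
Implicit Types f g : T -> R.

Lemma bounded_measurable_integrable f D : measurable D ->
  bounded_measurable f -> P.-integrable D (EFin \o f).
Proof.
move=> mD [mf [B hB]].
have mfD : measurable_fun D f by exact: measurable_funS mf.
apply: measurable_bounded_integrable => //.
  by rewrite (le_lt_trans (probability_le1 _ mD))// ltry.
exists B; split; first exact: num_real.
by move=> x Bx y Dy /=; rewrite (le_trans (hB _))// ltW.
Qed.

Lemma Ex_le f g : bounded_measurable f -> bounded_measurable g ->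
  (forall w, f w <= g w) -> \int[P]_w f w <= \int[P]_w g w.
Proof.
by move=> hf hg fg; apply: le_Rintegral => //;
  exact: bounded_measurable_integrable.
Qed.

Lemma ExD f g : bounded_measurable f -> bounded_measurable g ->
  \int[P]_w (f w + g w) = \int[P]_w f w + \int[P]_w g w.
Proof.
by move=> hf hg; apply: RintegralD => //;
  exact: bounded_measurable_integrable.
Qed.

Lemma ExZ c f : bounded_measurable f ->
  \int[P]_w (c * f w) = c * \int[P]_w f w.
Proof.
by move=> hf; apply: RintegralZl => //;
  exact: bounded_measurable_integrable.
Qed.

Lemma Ex_cst c : \int[P]_w c = c.
Proof.
by rewrite Rintegral_cst// [X in fine X](_ : _ = 1%E) ?mulr1//;
  exact: probability_setT.
Qed.

Lemma Ex_sum n (f : 'I_n -> T -> R) :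
  (forall i, bounded_measurable (f i)) ->
  \int[P]_w (\sum_(i < n) f i w) = \sum_(i < n) \int[P]_w f i w.
Proof.
elim: n f => [|n IH] f hf.
  by rewrite big_ord0; under eq_Rintegral do rewrite big_ord0; exact: Ex_cst.
under eq_Rintegral do rewrite big_ord_recr /=.
rewrite ExD// ?IH ?big_ord_recr//.
by apply: bounded_measurable_sum => i.
Qed.

Lemma Ex_indic (A : set T) : measurable A -> \int[P]_w \1_A w = fine (P A).
Proof. by move=> mA; rewrite /Rintegral integral_indic// setIT. Qed.

Lemma Ex_markov f (e : R) : 0 < e -> bounded_measurable f ->
  (forall w, 0 <= f w) ->
  fine (P [set w | e < f w]) <= (\int[P]_w f w) / e.
Proof.
move=> e0 hf f0.
have mA : measurable [set w | e < f w].
  rewrite -[X in measurable X]setTI.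
  have := hf.1 measurableT `]e, +oo[%classic (measurable_itv _).
  by congr (measurable (_ `&` _)); apply/seteqP; split=> w /=;
    rewrite in_itv/= andbT.
rewrite ler_pdivlMr// mulrC -Ex_indic// -ExZ; last first.
  split; first exact: measurable_indic.
  by exists 1 => w; rewrite indicE; case: (_ \in _); rewrite ?normr1 ?normr0.
apply: Ex_le => // [|w].
  apply: bounded_measurableZ; split; first exact: measurable_indic.
  by exists 1 => w; rewrite indicE; case: (_ \in _); rewrite ?normr1 ?normr0.
rewrite indicE; case: (boolP (w \in _)) => [/set_mem /ltW|_].
  by rewrite mulr1.
by rewrite mulr0.
Qed.

Lemma cells_trivIset {I : countType} (S : T -> I) :
  trivIset setT (fun n : nat => (pickle \o S) @^-1` [set n]).
Proof.
by apply/trivIsetP => i j _ _ /eqP ij; apply/seteqP;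
  split=> // w [/= -> /ij].
Qed.

Lemma cells_bigcup {I : countType} (S : T -> I) :
  \bigcup_n (pickle \o S) @^-1` [set n] = setT.
Proof. by apply/seteqP; split=> // w _; exists (pickle (S w)). Qed.

(** Total probability: countable additivity over the fibres of S. *)
Lemma cells_ge0 {I : countType} (S : T -> I) f : discrete_map S ->
  bounded_measurable f ->
  (forall i, 0 <= \int[P]_(w in S @^-1` [set i]) f w) -> 0 <= \int[P]_w f w.
Proof.
move=> dS hf h; rewrite /Rintegral -(cells_bigcup S) integral_bigcup.
- apply: fine_ge0; apply: nneseries_ge0 => n _ _.
  have [[i ni]|ni] := pselect (exists i : I, pickle i = n).
    rewrite (_ : _ @^-1` _ = S @^-1` [set i]); last first.
      by apply/seteqP; split=> w /=; rewrite -ni;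
        [move/(pcan_inj pickleK)|move=> ->].
    rewrite -[X in (_ <= X)%E]fineK ?lee_fin; first exact: h.
    apply: (@integrable_fin_num _ _ _ P _ _ (EFin \o f)); first exact: dS.
    by apply: bounded_measurable_integrable => //; exact: dS.
  rewrite (_ : _ @^-1` _ = set0) ?integral_set0//.
  by apply/seteqP; split=> // w /= hw; apply: ni; exists (S w).
- exact: cells_trivIset.
- by move=> n; exact: (discrete_comp (pickle : I -> nat) dS).
- by rewrite cells_bigcup; exact: bounded_measurable_integrable.
Qed.

Lemma cells_le {I : countType} (S : T -> I) f g : discrete_map S ->
  bounded_measurable f -> bounded_measurable g ->
  (forall i, \int[P]_(w in S @^-1` [set i]) f w <=
             \int[P]_(w in S @^-1` [set i]) g w) ->
  \int[P]_w f w <= \int[P]_w g w.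
Proof.
move=> dS hf hg h; rewrite -subr_ge0 -RintegralB//;
  try exact: bounded_measurable_integrable.
apply: (cells_ge0 dS) => [|i]; first exact: bounded_measurableB.
by rewrite RintegralB ?subr_ge0//; exact: bounded_measurable_integrable.
Qed.

Lemma Rintegral_null f (D : set T) : measurable D -> P D = 0%E ->
  measurable_fun setT f -> \int[P]_(w in D) f w = 0.
Proof.
move=> mD D0 mf; rewrite /Rintegral null_set_integral//.
by apply/measurable_EFinP; exact: measurable_funS mf.
Qed.

Lemma Ex_le_ae f g (N : set T) : measurable N -> P N = 0%E ->
  bounded_measurable f -> bounded_measurable g ->
  (forall w, ~ N w -> f w <= g w) -> \int[P]_w f w <= \int[P]_w g w.
Proof.
move=> mN N0 bf bg fg; rewrite /Rintegral.
rewrite !(negligible_integral mN measurableT _ N0);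
  try exact: bounded_measurable_integrable.
apply: le_Rintegral; try exact: measurableD;
  try (by apply: bounded_measurable_integrable => //; exact: measurableD).
by move=> w [_ Nw]; exact: fg.
Qed.

End Expectation.

(** Independence of A and X is only assumed on singletons.  For a nonnegative
    integrand both sides are the same series; a bounded one is shifted by its
    bound. *)
Lemma Rintegral_indep_cell {d} {T : measurableType d} {R : realType}
    (P : probability T R) (X : {mfun T >-> nat}) (mu : probability nat R)
    (A : set T) (psi : nat -> R) B : measurable A ->
  (forall n, P (A `&` X @^-1` [set n]) = P A * mu [set n])%E ->
  (forall n, `|psi n| <= B) ->
  \int[P]_(w in A) psi (X w) = fine (P A) * \int[mu]_n psi n.
Proof.
move=> mA hP.
have PAfin : P A \is a fin_num by exact: fin_num_measure.
have key (phi : nat -> R) B' : (forall n, 0 <= phi n) ->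
    (forall n, `|phi n| <= B') ->
    \int[P]_(w in A) phi (X w) = fine (P A) * \int[mu]_n phi n.
  move=> phi0 phiB.
  pose F n := A `&` X @^-1` [set n].
  have mF n : measurable (F n).
    by apply: measurableI => //; exact: discrete_mfun.
  have AF : A = \bigcup_n F n.
    by apply/seteqP; split=> [w Aw|w [n _ []]//]; exists (X w).
  have E1 : (\int[P]_(w in A) (phi (X w))%:E =
      \sum_(n <oo) (phi n)%:E * (P A * mu [set n]))%E.
    rewrite {1}AF ge0_integral_bigcup//.
    - apply: eq_eseriesr => n _.
      transitivity (\int[P]_(w in F n) (phi n)%:E)%E.
        by apply: eq_integral => w /set_mem [_ /= ->].
      by rewrite integral_cst//; congr *%E; exact: hP.
    - apply: (discrete_measurable_fun (fun n => (phi n)%:E)).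
        exact: discrete_mfun.
      exact: bigcup_measurable.
    - by move=> w _; rewrite lee_fin.
    - by apply/trivIsetP => i j _ _ /eqP ij; apply/seteqP;
      split=> // w [[_ Xi] [_ Xj]]; apply: ij; rewrite -Xi -Xj.
  have E2 : (\int[mu]_n (phi n)%:E = \sum_(n <oo) (phi n)%:E * mu [set n])%E.
    rewrite (_ : setT = \bigcup_n [set n]) ?ge0_integral_bigcup//.
    - apply: eq_eseriesr => n _.
      transitivity (\int[mu]_(w in [set n]) (phi n)%:E)%E.
        by apply: eq_integral => w /set_mem ->.
      by rewrite integral_cst.
    - by move=> w _; rewrite lee_fin.
    - by apply/trivIsetP => i j _ _ /eqP ij; apply/seteqP; split=> // w [/= ->].
    - by apply/seteqP; split=> // n _; exists n.
  rewrite /Rintegral E1 E2 -[X in _ = fine X * _](fineK PAfin) /=.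
  rewrite -{1}(fineK PAfin).
  under eq_eseriesr do rewrite muleCA.
  rewrite nneseriesZl; last by move=> i _; rewrite mule_ge0// lee_fin.
  rewrite fineM// -E2.
  apply: (@integrable_fin_num _ _ _ mu setT measurableT (EFin \o phi)).
  by apply: bounded_measurable_integrable => //; split=> //; exists B'.
move=> hB.
have bmX : bounded_measurable (fun w => psi (X w)).
  by apply: (@bounded_measurable_comp _ _ _ _ X psi B) => //;
    exact: discrete_mfun.
have bmn : bounded_measurable psi by split => //; exists B.
have := key (fun n => psi n + B) (B + `|B|).
rewrite RintegralD//; last 2 first.
  by apply: bounded_measurable_integrable.
  by apply: bounded_measurable_integrable => //; exact: bounded_measurable_cst.
rewrite ExD//; last exact: bounded_measurable_cst.
rewrite Rintegral_cst// Ex_cst mulrDr [B * _]mulrC => H.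
apply: (addIr (fine (P A) * B)).
rewrite H//= => n.
  by have := hB n; rewrite ler_norml => /andP[]; lra.
by rewrite (le_trans (ler_normD _ _))// lerD.
Qed.

(** * Independent draws and their effect on the degrees *)

Section Sampling.
Context {R : realType} {V : finType} (a : V -> R).
Hypothesis a0 : forall v, 0 <= a v.
Hypothesis a1 : \sum_v a v = 1.
Variable n : nat.
Implicit Types F G : {ffun 'I_n -> V} -> R.

(** Expectation under the product law of n independent draws of law a. *)
Definition sampleE F : R := \sum_(s : {ffun 'I_n -> V}) (\prod_j a (s j)) * F s.

Definition meanE (f : V -> R) : R := \sum_v a v * f v.

Lemma sampleE_prod (f : 'I_n -> V -> R) :
  sampleE (fun s => \prod_j f j (s j)) = \prod_j meanE (f j).
Proof.
rewrite /meanE bigA_distr_bigA /=; apply: eq_bigr => s _.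
by rewrite -big_split.
Qed.

Lemma sampleE_cst c : sampleE (fun _ => c) = c.
Proof.
rewrite /sampleE -big_distrl /= -(bigA_distr_bigA (fun _ => a)).
by rewrite big1 ?mul1r.
Qed.

Lemma sampleED F G : sampleE (fun s => F s + G s) = sampleE F + sampleE G.
Proof. by rewrite -big_split; apply: eq_bigr => s _; rewrite mulrDr. Qed.

Lemma sampleEZ c F : sampleE (fun s => c * F s) = c * sampleE F.
Proof. by rewrite big_distrr; apply: eq_bigr => s _; rewrite mulrCA. Qed.

Lemma sampleE_sum {I : finType} (F : I -> {ffun 'I_n -> V} -> R) :
  sampleE (fun s => \sum_i F i s) = \sum_i sampleE (F i).
Proof. by rewrite exchange_big; apply: eq_bigr => s _; rewrite big_distrr. Qed.

Lemma sampleE_le F G : (forall s, F s <= G s) -> sampleE F <= sampleE G.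
Proof.
by move=> FG; apply: ler_sum => s _; rewrite ler_wpM2l// prodr_ge0.
Qed.

Lemma sampleE_norm F G c : (forall s, `|F s - G s| <= c s) ->
  `|sampleE F - sampleE G| <= sampleE c.
Proof.
move=> FG; rewrite ler_norml; apply/andP; split.
  rewrite lerBrDr addrC lerBlDr -sampleED sampleE_le// => s.
  by have := FG s; rewrite ler_norml => /andP[]; lra.
rewrite lerBlDr -sampleED sampleE_le// => s.
by have := FG s; rewrite ler_norml => /andP[]; lra.
Qed.

Lemma meanE1 : meanE (fun=> 1) = 1.
Proof. by rewrite -[RHS]a1; apply: eq_bigr => v _; rewrite mulr1. Qed.

Lemma sampleE_one j f : sampleE (fun s => f (s j)) = meanE f.
Proof.
have := sampleE_prod (fun i => if i == j then f else fun=> 1).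
rewrite [RHS](bigD1 j)//= eqxx [X in _ * X]big1 => [|i /negPf->];
  last exact: meanE1.
rewrite mulr1 => <-; apply: eq_bigr => s _; congr (_ * _).
by rewrite (bigD1 j)//= eqxx big1 ?mulr1// => i /negPf->.
Qed.

Lemma sampleE_two i j f g : i != j ->
  sampleE (fun s => f (s i) * g (s j)) = meanE f * meanE g.
Proof.
move=> ij; have ji : j != i by rewrite eq_sym.
have := sampleE_prod (fun l =>
  if l == i then f else if l == j then g else fun=> 1).
rewrite [RHS](bigD1 i)//= eqxx [X in _ * X](bigD1 j)//= (negPf ji) eqxx.
rewrite [X in _ * (_ * X)]big1 => [|l /andP[/negPf-> /negPf->]];
  last exact: meanE1.
rewrite mulr1 => <-; apply: eq_bigr => s _; congr (_ * _).
rewrite (bigD1 i)//= eqxx (bigD1 j)//= (negPf ji) eqxx big1 ?mulr1//.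
by move=> l /andP[/negPf-> /negPf->].
Qed.

Lemma sampleE_lin f : sampleE (fun s => \sum_j f (s j)) = n%:R * meanE f.
Proof.
rewrite sampleE_sum; under eq_bigr do rewrite sampleE_one.
by rewrite sumr_const card_ord mulr_natl.
Qed.

(** The diagonal pairs of draws give the first term, the others, being
    independent, the second. *)
Lemma sampleE_sqr f : sampleE (fun s => (\sum_j f (s j)) ^+ 2) =
  n%:R * meanE (fun v => f v ^+ 2) + n%:R * (n%:R - 1) * meanE f ^+ 2.
Proof.
under [X in sampleE X]eq_fun do rewrite expr2 big_distrlr /=.
rewrite sampleE_sum.
transitivity (\sum_(i < n) (meanE (fun v => f v ^+ 2) +
                            \sum_(j < n | j != i) meanE f ^+ 2)).
  apply: eq_bigr => i _; rewrite sampleE_sum (bigD1 i)//=; congr (_ + _).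
    exact: (sampleE_one i (fun v => f v ^+ 2)).
  by apply: eq_bigr => j ji; rewrite sampleE_two 1?eq_sym// -expr2.
rewrite big_split /= sumr_const card_ord mulr_natl; congr (_ + _).
transitivity (\sum_(i < n) (n%:R - 1) * meanE f ^+ 2).
  apply: eq_bigr => i _; rewrite sumr_const -[LHS]mulr_natl; congr (_ * _).
  rewrite (_ : #|_| = n.-1) ?predn_sub ?subn1.
    by case: n i => [[]//|n' _]; rewrite -natr1 addrK.
  by rewrite (cardC1 i) card_ord.
by rewrite sumr_const card_ord -[LHS]mulr_natl mulrA.
Qed.

Definition hits (s : {ffun 'I_n -> V}) (v : V) : nat := \sum_j (s j == v).

Lemma sum_hits (s : {ffun 'I_n -> V}) f :
  \sum_v (hits s v)%:R * f v = \sum_j f (s j) :> R.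
Proof.
under eq_bigr do rewrite natr_sum big_distrl /=.
rewrite exchange_big /=; apply: eq_bigr => j _.
rewrite (bigD1 (s j))//= eqxx mul1r big1 ?addr0// => v /negPf sv.
by rewrite eq_sym sv mul0r.
Qed.

Lemma meanE_pred1 v : meanE (fun w => (w == v)%:R) = a v.
Proof.
rewrite /meanE (bigD1 v)//= eqxx mulr1 big1 ?addr0// => w /negPf->.
by rewrite mulr0.
Qed.

(** [K ^+ 2 - K] counts the ordered pairs of distinct draws that select v. *)
Lemma sampleE_hits_pairs v :
  sampleE (fun s => (hits s v)%:R ^+ 2 - (hits s v)%:R) =
  n%:R * (n%:R - 1) * a v ^+ 2.
Proof.
under [X in sampleE X]eq_fun do rewrite -mulN1r /hits natr_sum.
rewrite sampleED sampleEZ.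
rewrite (sampleE_sqr (fun w => (w == v)%:R)) (sampleE_lin (fun w =>
  (w == v)%:R)).
rewrite (_ : (fun w => (w == v)%:R ^+ 2) = (fun w => (w == v)%:R : R)).
  by rewrite meanE_pred1; ring.
by apply/funext => w; case: eqP; rewrite ?expr1n ?expr0n.
Qed.

End Sampling.

(** To first order in K, a vertex of degree k is lost and one of degree k - 1 is
    gained at each hit; only vertices hit at least twice contribute to the
    error. *)
Lemma degree_change_first_order (R : realType) (k d K : nat) : (0 < k)%N ->
  `|((d + K == k)%N%:R - (d == k)%:R) - K%:R * ((d.+1 == k)%:R - (d == k)%:R)|
  <= (d <= k)%:R * (K%:R ^+ 2 - K%:R) :> R.
Proof.
move=> k0; case: K => [|[|K]].
- by rewrite addn0 !subrr mul0r subr0 normr0 expr0n /= subrr mulr0.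
- by rewrite addn1 mul1r subrr normr0 expr1n subrr mulr0.
have K2 : 2 <= K.+2%:R :> R by rewrite ler_nat.
set x := K.+2%:R in K2 *.
have [dk|kd] := leqP d k; last first.
  rewrite !gtn_eqF ?mul0r ?subrr ?mulr0 ?subrr ?normr0//; last 2 first.
  - exact: leqW.
  - by rewrite (leq_trans kd)// leq_addr.
rewrite mul1r.
have [->|dk'] := eqVneq d k.
  have -> : (k + K.+2 == k)%N = false by lia.
  have -> : (k.+1 == k) = false by lia.
  rewrite /= ler_norml; nra.
have [dk1|dk1] := eqVneq d.+1 k.
  have -> : (d + K.+2 == k)%N = false by lia.
  rewrite /= ler_norml; nra.
rewrite /= ler_norml.
by case: (_ == _) => /=; nra.
Qed.

Lemma degree_change_bound (R : realType) (k d K : nat) :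
  `|(d + K == k)%N%:R - (d == k)%:R| <= (d <= k)%:R * K%:R :> R.
Proof.
have [dk|kd] := leqP d k; last first.
  by rewrite !gtn_eqF ?mul0r ?subrr ?normr0// (leq_trans kd)// leq_addr.
case: K => [|K]; first by rewrite addn0 subrr normr0 mulr0.
rewrite mul1r (@le_trans _ _ 1)//; last by rewrite ler1n.
by case: (_ == k); case: (_ == k);
  rewrite ?subrr ?subr0 ?sub0r ?normrN ?normr0 ?normr1.
Qed.

Section DegreeSampling.
Context {R : realType} {V : finType} (deg : V -> nat) (L : nat) (k : nat).
Hypothesis L0 : (0 < L)%N.
Hypothesis degL : (\sum_v deg v = 2 * L)%N.
Hypothesis k0 : (0 < k)%N.

Definition degree_weight (v : V) : R := (deg v)%:R / (2 * L%:R).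

Definition count_degree (j : nat) : R := \sum_v (deg v == j)%:R.

Definition degree_gain n (s : {ffun 'I_n -> V}) : R :=
  \sum_v ((deg v + hits s v == k)%N%:R - (deg v == k)%:R).

Let L0R : 0 < L%:R :> R. Proof. by rewrite ltr0n. Qed.

Lemma degree_weight_ge0 v : 0 <= degree_weight v.
Proof. by rewrite divr_ge0// mulr_ge0. Qed.

Lemma sum_degree_weight : \sum_v degree_weight v = 1.
Proof.
rewrite -big_distrl /= -natr_sum degL natrM divff//.
by rewrite mulf_neq0// ?gt_eqF// ltr0n.
Qed.

Let cardV_ge0 : 0 <= #|V|%:R :> R. Proof. by []. Qed.

Lemma degree_gain_bound n (s : {ffun 'I_n -> V}) : `|degree_gain s| <= #|V|%:R.
Proof.
rewrite (le_trans (ler_norm_sum _ _ _))//.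
rewrite (le_trans (_ : _ <= \sum_(v : V) 1))//; last by rewrite sumr_const.
apply: ler_sum => v _.
by case: (_ == k); case: (_ == k);
  rewrite ?subrr ?subr0 ?sub0r ?normrN ?normr0 ?normr1.
Qed.

Lemma count_degree_bound j : 0 <= count_degree j <= #|V|%:R.
Proof.
rewrite sumr_ge0//= (le_trans (_ : _ <= \sum_(v : V) 1))//;
  last by rewrite sumr_const.
by apply: ler_sum => v _; case: (_ == j).
Qed.

Lemma meanE_drift :
  meanE degree_weight (fun v => ((deg v).+1 == k)%:R - (deg v == k)%:R) =
  (k.-1%:R * count_degree k.-1 - k%:R * count_degree k) / (2 * L%:R).
Proof.
rewrite /meanE /count_degree !big_distrr /= -sumrB big_distrl /=.
apply: eq_bigr => v _; rewrite /degree_weight mulrAC; congr (_ / _).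
rewrite mulrBr; congr (_ - _).
  case: eqP => [dk|dk]; first by rewrite -dk /= eqxx.
  by case: eqP => [dk'|]; rewrite ?mulr0//; case: dk; rewrite dk' prednK.
by case: eqP => [->|]; rewrite ?mulr0.
Qed.

Let weight_bound v : (deg v <= k)%N -> degree_weight v <= k%:R / (2 * L%:R).
Proof. by move=> dk; rewrite ler_wpM2r ?invr_ge0 ?mulr_ge0// ler_nat. Qed.

(** The scale on which a batch of n draws acts: proportional to n for small
    batches, and bounded for the huge ones that a law of infinite mean
    produces. *)
Definition batch_ratio (n : nat) : R := (minn n L)%:R / L%:R.

Lemma batch_ratio_ge0 n : 0 <= batch_ratio n.
Proof. exact: divr_ge0. Qed.

Lemma batch_ratio_small n : (n <= L)%N -> n%:R = batch_ratio n * L%:R.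
Proof. by move=> nL; rewrite /batch_ratio (minn_idPl nL) divfK// gt_eqF. Qed.

Lemma batch_ratio_large n : (L <= n)%N -> batch_ratio n = 1.
Proof. by move=> nL; rewrite /batch_ratio (minn_idPr nL) divff// gt_eqF. Qed.

Let k1 : 1 <= k%:R :> R. Proof. by rewrite ler1n. Qed.

(** Small batches are expanded to first order, with an error bounded by the
    mean number of double hits.  For a batch with more edges than the graph the
    trivial bounds suffice, as its [batch_ratio] is 1. *)
Lemma degree_gain_mean n :
  `|sampleE degree_weight (@degree_gain n) -
    batch_ratio n * ((k.-1%:R * count_degree k.-1 - k%:R * count_degree k) / 2)|
  <= k.+1%:R ^+ 2 * #|V|%:R * batch_ratio n ^+ 2.
Proof.
have kS : k.+1%:R = k%:R + 1 :> R by rewrite natr1.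
have [nL|Ln] := leqP n L; last first.
  rewrite batch_ratio_large ?(ltnW Ln)// mul1r expr1n mulr1.
  have /andP[c0 cV] := count_degree_bound k.
  have /andP[c0' cV'] := count_degree_bound k.-1.
  have k'0 : 0 <= k.-1%:R :> R by [].
  have k'k : k.-1%:R <= k%:R :> R by rewrite ler_nat leq_pred.
  have hD : `|sampleE degree_weight (@degree_gain n)| <= #|V|%:R.
    rewrite -[X in `|X|]subr0 -[X in _ - X](sampleE_cst sum_degree_weight n 0).
    rewrite -[leRHS](sampleE_cst sum_degree_weight n).
    apply: sampleE_norm => [|s]; first exact: degree_weight_ge0.
    by rewrite subr0 degree_gain_bound.
  rewrite kS; set e := sampleE _ _ in hD *; set c := count_degree k in c0 cV *.
  set c' := count_degree k.-1 in c0' cV' *; have k1' := k1;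
    set K := k%:R in k1' k'k *.
  set K' := k.-1%:R in k'0 k'k *; set v := #|V|%:R in hD cV cV' *.
  have h1 : 0 <= K' * c' <= K * v by rewrite mulr_ge0//= ler_pM.
  have h2 : 0 <= K * c <= K * v by rewrite mulr_ge0 ?ler_pM//; lra.
  move: hD; rewrite !ler_norml; nra.
have hn := batch_ratio_small nL; have u0 := batch_ratio_ge0 n.
set u := batch_ratio n in hn u0 *.
pose tau v : R := ((deg v).+1 == k)%:R - (deg v == k)%:R.
have -> : u * ((k.-1%:R * count_degree k.-1 - k%:R * count_degree k) / 2) =
    sampleE degree_weight (fun s : {ffun 'I_n -> V} =>
      \sum_v (hits s v)%:R * tau v).
  under [X in sampleE _ X]eq_fun do rewrite sum_hits.
  rewrite sampleE_lin ?sum_degree_weight// meanE_drift hn; field.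
  by rewrite gt_eqF.
apply: (@le_trans _ _ (sampleE degree_weight (fun s : {ffun 'I_n -> V} =>
    \sum_v (deg v <= k)%:R * ((hits s v)%:R ^+ 2 - (hits s v)%:R)))).
  apply: sampleE_norm => [|s]; first exact: degree_weight_ge0.
  rewrite -sumrB (le_trans (ler_norm_sum _ _ _))//.
  by apply: ler_sum => v _; exact: degree_change_first_order.
rewrite sampleE_sum (@le_trans _ _ (\sum_(v : V) (k%:R * u) ^+ 2))//;
  last first.
  rewrite sumr_const -[leLHS]mulr_natl kS exprMn mulrCA mulrA.
  by rewrite ler_wpM2r ?sqr_ge0// ler_wpM2r//; have := k1; nra.
apply: ler_sum => v _; rewrite sampleEZ sampleE_hits_pairs ?sum_degree_weight//.
have [dk|] := leqP (deg v) k; last by rewrite mul0r sqr_ge0.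
rewrite mul1r.
have w0 := degree_weight_ge0 v; have := weight_bound dk.
set w := degree_weight v in w0 *.
rewrite ler_pdivlMr ?mulr_gt0// => wk.
have nw : n%:R * w <= k%:R * u / 2 by rewrite hn; nra.
have nw0 : 0 <= n%:R * w by rewrite mulr_ge0.
rewrite (@le_trans _ _ ((n%:R * w) ^+ 2))//.
  rewrite [leRHS]exprMn ler_wpM2r ?sqr_ge0// expr2 ler_wpM2l//; lra.
rewrite ler_pXn2r ?nnegrE//; last by rewrite mulr_ge0.
have ku0 : 0 <= k%:R * u by rewrite mulr_ge0.
by rewrite (le_trans nw)//; lra.
Qed.

(** For a small batch the gain is at most the number of draws that select a
    vertex of degree at most k, whose total weight is O(#|V| / L). *)
Lemma degree_gain_second_moment n :
  sampleE degree_weight (fun s : {ffun 'I_n -> V} => degree_gain s ^+ 2) <=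
  k.+1%:R ^+ 2 * (#|V|%:R * batch_ratio n + #|V|%:R ^+ 2 * batch_ratio n ^+ 2).
Proof.
have kS : k.+1%:R = k%:R + 1 :> R by rewrite natr1.
have [nL|Ln] := leqP n L; last first.
  rewrite batch_ratio_large ?(ltnW Ln)// expr1n !mulr1.
  rewrite (@le_trans _ _ (#|V|%:R ^+ 2))//; last first.
    rewrite (@le_trans _ _ (#|V|%:R + #|V|%:R ^+ 2))// ?lerDr//.
    by rewrite ler_peMl ?addr_ge0 ?sqr_ge0// kS; have := k1; nra.
  rewrite -[leRHS](sampleE_cst sum_degree_weight n).
  apply: sampleE_le => [|s]; first exact: degree_weight_ge0.
  by rewrite -[leLHS]real_normK ?num_real// ler_pXn2r ?nnegrE//
    degree_gain_bound.
have hn := batch_ratio_small nL; have u0 := batch_ratio_ge0 n.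
set u := batch_ratio n in hn u0 *.
pose f v : R := (deg v <= k)%:R.
apply: (@le_trans _ _ (sampleE degree_weight
    (fun s : {ffun 'I_n -> V} => (\sum_j f (s j)) ^+ 2))).
  apply: sampleE_le => [|s]; first exact: degree_weight_ge0.
  rewrite -[leLHS]real_normK ?num_real// ler_pXn2r ?nnegrE//;
    last exact: sumr_ge0.
  rewrite (le_trans (ler_norm_sum _ _ _))// -(sum_hits s f).
  by apply: ler_sum => v _; rewrite mulrC; exact: degree_change_bound.
rewrite sampleE_sqr ?sum_degree_weight//.
have -> : (fun v => f v ^+ 2) = f.
  by apply/funext => v; rewrite /f; case: (_ <= _)%N; rewrite ?expr1n ?expr0n.
have y0 : 0 <= meanE degree_weight f.
  by apply: sumr_ge0 => v _; rewrite mulr_ge0// degree_weight_ge0.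
have yV : meanE degree_weight f <= #|V|%:R * (k%:R / (2 * L%:R)).
  rewrite (@le_trans _ _ (\sum_(v : V) k%:R / (2 * L%:R)))//; last first.
    by rewrite sumr_const -[leLHS]mulr_natl.
  apply: ler_sum => v _; rewrite /f; case: leqP => [dk|_].
    by rewrite mulr1 weight_bound.
  by rewrite mulr0 divr_ge0 ?mulr_ge0.
set y := meanE _ _ in y0 yV *; have v0 := cardV_ge0;
  set v := #|V|%:R in yV v0 *.
have vk0 : 0 <= v * k%:R by rewrite mulr_ge0.
have ny : n%:R * y <= v * k%:R * u / 2.
  have : u * L%:R * y <= u * L%:R * (v * (k%:R / (2 * L%:R))).
    by rewrite ler_wpM2l// mulr_ge0// ltW.
  rewrite hn (_ : _ * (v * _) = v * k%:R * u / 2)//; field.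
  by rewrite gt_eqF.
have ny0 : 0 <= n%:R * y by rewrite mulr_ge0.
have vku0 : 0 <= v * k%:R * u by rewrite mulr_ge0.
have h1 : n%:R * (n%:R - 1) * y ^+ 2 <= (v * k%:R * u) ^+ 2.
  rewrite (@le_trans _ _ ((n%:R * y) ^+ 2))//.
    rewrite [leRHS]exprMn ler_wpM2r ?sqr_ge0// expr2 ler_wpM2l//; lra.
  by rewrite ler_pXn2r ?nnegrE//; lra.
have kk : k%:R <= (k%:R + 1) ^+ 2 :> R by nra.
have h2 : v * k%:R * u <= (k%:R + 1) ^+ 2 * (v * u).
  rewrite (_ : v * k%:R * u = k%:R * (v * u)); last by ring.
  by rewrite ler_wpM2r// mulr_ge0.
have h3 : (v * k%:R * u) ^+ 2 <= (k%:R + 1) ^+ 2 * (v ^+ 2 * u ^+ 2).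
  rewrite (_ : (v * k%:R * u) ^+ 2 = k%:R ^+ 2 * (v ^+ 2 * u ^+ 2));
    last by ring.
  by rewrite ler_wpM2r ?mulr_ge0 ?sqr_ge0//; have := k1; nra.
by rewrite kS mulrDr; lra.
Qed.

End DegreeSampling.

(** * Tails and truncated means of a law on the natural numbers *)

Section NatLaw.
Context {R : realType} (mu : probability nat R).

Definition tail (j : nat) : R := fine (mu [set n | (j <= n)%N]).

Definition trunc_mean (M : nat) : R := \sum_(j < M) tail j.+1.

Lemma bounded_measurable_nat (psi : nat -> R) B :
  (forall n, `|psi n| <= B) -> bounded_measurable psi.
Proof. by move=> hB; split=> //; exists B. Qed.

Lemma tail_ge0 j : 0 <= tail j. Proof. exact: fine_ge0. Qed.

Lemma Ex_tail j : \int[mu]_n (j <= n)%N%:R = tail j.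
Proof.
rewrite /tail -Ex_indic//; apply: eq_Rintegral => n _; rewrite indicE.
by congr (nat_of_bool _)%:R; apply/idP/idP => [|/set_mem]//; rewrite in_setE.
Qed.

Lemma Ex_point j : \int[mu]_n (n == j)%:R = fine (mu [set j]).
Proof.
rewrite -Ex_indic//; apply: eq_Rintegral => n _; rewrite indicE.
by congr (nat_of_bool _)%:R; apply/idP/idP => [/eqP->|/set_mem->]//;
  rewrite in_setE.
Qed.

Lemma bool_bounded (p : nat -> bool) : bounded_measurable (fun n =>
  (p n)%:R : R).
Proof.
apply: (@bounded_measurable_nat _ 1) => n.
by case: (p n); rewrite ?normr1 ?normr0.
Qed.

Lemma tail_le1 j : tail j <= 1.
Proof.
rewrite -Ex_tail -[leRHS](Ex_cst mu); apply: Ex_le.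
- exact: bool_bounded.
- exact: bounded_measurable_cst.
- by move=> n; case: leqP.
Qed.

Lemma minn_sum n M : minn n M = (\sum_(j < M) (j < n)%N)%N.
Proof.
elim: M => [|M IH]; first by rewrite minn0 big_ord0.
by rewrite big_ord_recr /= -IH; lia.
Qed.

(** Writing the square as a combination of indicators of the events [j < n]
    turns its mean into a combination of tails. *)
Lemma minn_sqr_sum n M :
  (minn n M ^ 2)%N = (\sum_(j < M) (2 * j + 1) * (j < n)%N)%N.
Proof.
elim: M => [|M IH]; first by rewrite minn0 big_ord0.
rewrite big_ord_recr /= -IH; case: ltnP => Mn; last first.
  by rewrite !(minn_idPl _) ?muln0 ?addn0// leqW.
by rewrite !(minn_idPr _)// ?(ltnW Mn)//; lia.
Qed.

Lemma Ex_minn M : \int[mu]_n (minn n M)%:R = trunc_mean M.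
Proof.
under eq_Rintegral do rewrite minn_sum natr_sum.
rewrite Ex_sum; last by move=> i; exact: bool_bounded.
by apply: eq_bigr => j _; rewrite Ex_tail.
Qed.

Lemma trunc_mean_ge0 M : 0 <= trunc_mean M.
Proof. by apply: sumr_ge0 => j _; exact: tail_ge0. Qed.

Lemma trunc_mean_le M : trunc_mean M <= M%:R.
Proof.
rewrite (@le_trans _ _ (\sum_(j < M) 1))//; last by rewrite sumr_const card_ord.
by apply: ler_sum => j _; exact: tail_le1.
Qed.

Lemma trunc_meanS M : trunc_mean M.+1 = trunc_mean M + tail M.+1.
Proof. by rewrite /trunc_mean big_ord_recr. Qed.

Lemma trunc_mean_mono M N : (M <= N)%N -> trunc_mean M <= trunc_mean N.
Proof.
move=> /subnKC <-; elim: (N - M)%N => [|i IH]; first by rewrite addn0.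
by rewrite addnS trunc_meanS (le_trans IH)// lerDl tail_ge0.
Qed.

Lemma tail1 : mu [set 0%N] = 0%E -> tail 1 = 1.
Proof.
move=> mu0; rewrite -Ex_tail.
transitivity (\int[mu]_n (1 + (-1) * (n == 0)%N%:R)).
  by apply: eq_Rintegral => -[|n] _ //=; rewrite ?mulr1 ?subrr ?mulr0 ?addr0.
rewrite ExD; first last.
- by apply: bounded_measurableZ; exact: bool_bounded.
- exact: bounded_measurable_cst.
rewrite ExZ; last exact: bool_bounded.
by rewrite Ex_cst (Ex_point 0) mu0 /= mulr0 addr0.
Qed.

Lemma trunc_mean_ge1 M : mu [set 0%N] = 0%E -> (0 < M)%N -> 1 <= trunc_mean M.
Proof.
move=> mu0 M0; rewrite (le_trans _ (trunc_mean_mono M0))//.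
by rewrite /trunc_mean big_ord_recr big_ord0 /= add0r tail1.
Qed.

Section TailBound.
Variable c : R.
Hypothesis tail_le : forall j, tail j.+1 <= c / j.+1%:R.

Lemma tail_cst_ge0 : 0 <= c.
Proof. by have := le_trans (tail_ge0 1) (tail_le 0); rewrite divr1. Qed.

Lemma Ex_minn_sqr M : \int[mu]_n ((minn n M)%:R ^+ 2) <= 2 * c * M%:R.
Proof.
have c0 := tail_cst_ge0.
apply: (@le_trans _ _ (\sum_(j < M) (2 * j + 1)%N%:R * tail j.+1)).
  under eq_Rintegral do rewrite -natrX minn_sqr_sum natr_sum.
  rewrite Ex_sum => [|i].
    apply: ler_sum => j _; rewrite -Ex_tail -ExZ; last exact: bool_bounded.
    by under eq_Rintegral do rewrite natrM.
  under eq_fun do rewrite natrM.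
  by apply: bounded_measurableZ; exact: bool_bounded.
rewrite (@le_trans _ _ (\sum_(j < M) 2 * c))//; last first.
  by rewrite sumr_const card_ord mulr_natr.
apply: ler_sum => j _.
rewrite (@le_trans _ _ ((2 * j + 1)%N%:R * (c / j.+1%:R)))//.
  exact: ler_wpM2l.
rewrite mulrCA mulrC ler_wpM2r// ler_pdivrMr ?ltr0n// -natrM ler_nat; lia.
Qed.

Lemma trunc_mean_le_add M N : (0 < M)%N -> (M <= N)%N ->
  trunc_mean N <= trunc_mean M + c * (N%:R - M%:R) / M%:R.
Proof.
move=> M0 /subnKC <-; elim: (N - M)%N => [|i IH].
  by rewrite addn0 subrr mulr0 mul0r addr0.
rewrite addnS trunc_meanS (le_trans (lerD IH (tail_le _)))//.
rewrite -addrA lerD2l.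
have c0 := tail_cst_ge0.
have -> : c * ((M + i).+1%:R - M%:R) / M%:R =
    c * ((M + i)%:R - M%:R) / M%:R + c / M%:R.
  by rewrite -natr1; field; rewrite pnatr_eq0; lia.
rewrite lerD2l ler_wpM2l// lef_pV2 ?posrE ?ltr0n//.
by rewrite ler_nat; lia.
Qed.

Lemma trunc_mean_mul M L : (0 < M)%N -> (0 < L)%N ->
  trunc_mean (M * L) <= trunc_mean M + c * L%:R.
Proof.
move=> M0 L0; have c0 := tail_cst_ge0.
rewrite (le_trans (trunc_mean_le_add M0 (leq_pmulr _ L0)))// lerD2l.
rewrite ler_pdivrMr ?ltr0n// -mulrA ler_wpM2l// natrM mulrC.
by rewrite lerBlDr lerDl.
Qed.

(** Slow variation of the truncated mean, uniformly over all larger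
    truncation levels.  Splitting the increment at [M * L] replaces the
    logarithm that the tail bound would give by an arbitrarily small
    multiple of [N / M]. *)
Lemma trunc_mean_slow M L N : (0 < M)%N -> (0 < L)%N ->
  trunc_mean N <= trunc_mean M + c * L%:R + c / L%:R * (N%:R / M%:R).
Proof.
move=> M0 L0; have c0 := tail_cst_ge0.
have h := trunc_mean_mul M0 L0.
have z0 : 0 <= c / L%:R * (N%:R / M%:R) by rewrite mulr_ge0 ?divr_ge0.
have [NM|MN] := leqP N (M * L).
  by have := trunc_mean_mono NM; lra.
have ML0 : (0 < M * L)%N by rewrite muln_gt0 M0.
rewrite (le_trans (trunc_mean_le_add ML0 (ltnW MN)))// lerD//.
rewrite (_ : c / L%:R * _ = c * N%:R / (M * L)%:R); last first.
  by rewrite natrM; field; rewrite !pnatr_eq0; lia.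
by rewrite ler_wpM2r ?invr_ge0// ler_wpM2l// lerBlDr lerDl.
Qed.

End TailBound.

Lemma tail_partial_sum j n :
  \sum_(i < n) fine (mu [set (j + i)%N]) <= tail j.
Proof.
rewrite -Ex_tail; under eq_bigr do rewrite -Ex_point.
rewrite -Ex_sum => [|i]; last exact: bool_bounded.
apply: Ex_le => [||m].
- by apply: bounded_measurable_sum => i; exact: bool_bounded.
- exact: bool_bounded.
have [jm|mj] := leqP j m; last first.
  by rewrite big1// => i _; rewrite ltn_eqF// (leq_trans mj)// leq_addr.
have [mn|nm] := ltnP (m - j) n; last first.
  by rewrite big1// => i _; rewrite gtn_eqF//; have := ltn_ord i; lia.
rewrite (bigD1 (Ordinal mn))//= subnKC// eqxx big1 ?addr0// => i ij.
case: eqP => // mE; case/eqP: ij; apply/val_inj => /=; lia.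
Qed.

Lemma tail_series_le j B :
  (forall n, \sum_(i < n) fine (mu [set (j + i)%N]) <= B) -> tail j <= B.
Proof.
move=> hB.
have E : (mu [set n | (j <= n)%N] = \sum_(i <oo) mu [set (j + i)%N])%E.
  rewrite (_ : [set n | _] = \bigcup_i [set (j + i)%N]).
    apply: measure_semi_bigcup => //.
    apply/trivIsetP => a b _ _ ab; apply/seteqP; split=> // n [/= -> /eqP].
    by rewrite eqn_add2l (negPf ab).
  apply/seteqP; split=> n /= => [jn|[i _ ->]]; last exact: leq_addr.
  by exists (n - j)%N => //=; rewrite subnKC.
rewrite /tail -lee_fin fineK ?fin_num_measure// E.
apply: lime_le; first exact: is_cvg_nneseries.
apply: nearW => n; rewrite (_ : (\sum_(0 <= i < n) mu [set (j + i)%N])%E =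
    (\sum_(i < n) fine (mu [set (j + i)%N]))%:E); first by rewrite lee_fin.
rewrite big_mkord -sumEFin; apply: eq_bigr => i _.
by rewrite fineK// fin_num_measure.
Qed.

End NatLaw.

Section PowerLaw.
Context {R : realType} (mu : probability nat R) (beta : R).
Hypothesis mu0 : mu [set 0%N] = 0%E.
Hypothesis muE : forall i, (0 < i)%N -> mu [set i] = (beta * i%:R ^- 2)%:E.

(* Telescoping: 1 / (x + 1)^2 <= 1 / x - 1 / (x + 1). *)
Let sum_inv_sqr (j n : nat) :
  \sum_(i < n.+1) (j.+1 + i)%:R ^- 2 <= 2 / j.+1%:R - (j.+1 + n)%:R^-1 :> R.
Proof.
elim: n => [|n IH].
  rewrite big_ord_recr big_ord0 /= add0r addn0 -exprVn.
  have : j.+1%:R^-1 <= 1 :> R by rewrite invf_le1 ?ltr0n// ler1n.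
  have : 0 <= j.+1%:R^-1 :> R by [].
  by set x := _^-1; nra.
rewrite big_ord_recr /= (le_trans (lerD IH (lexx _)))//.
rewrite -addrA lerD2l addnS.
have x0 : 0 < (j.+1 + n)%:R :> R by rewrite ltr0n.
rewrite -natr1; set x := (j.+1 + n)%:R in x0 *.
have x10 : 0 < x + 1 by rewrite addr_gt0.
rewrite addrC lerBlDr addrC -subr_ge0.
rewrite (_ : _ - _ = (x * (x + 1) ^+ 2)^-1).
  by rewrite invr_ge0 mulr_ge0 ?sqr_ge0// ltW.
by field; rewrite !gt_eqF.
Qed.

Let beta_ge0 : 0 <= beta.
Proof.
have : (0 <= mu [set 1%N])%E by [].
by rewrite muE// lee_fin expr1n invr1 mulr1.
Qed.

Let beta_le1 : beta <= 1.
Proof.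
have : (mu [set 1%N] <= 1)%E by exact: probability_le1.
by rewrite muE// lee_fin expr1n invr1 mulr1.
Qed.

Lemma power_law_tail j : tail mu j.+1 <= beta * (2 / j.+1%:R).
Proof.
apply: tail_series_le => -[|n]; first by rewrite big_ord0 mulr_ge0// divr_ge0.
under eq_bigr do rewrite muE//=.
rewrite -big_distrr /= ler_wpM2l// (le_trans (sum_inv_sqr _ _))//.
by rewrite lerBlDr lerDl.
Qed.

Lemma power_law_tail2 j : tail mu j.+1 <= 2 / j.+1%:R.
Proof.
by rewrite (le_trans (power_law_tail j))// -[leRHS]mul1r ler_wpM2r// divr_ge0.
Qed.

(* The total mass is 1, so the tail bound at 0 bounds beta from below. *)
Let beta_ge : 2^-1 <= beta.
Proof. by have := power_law_tail 0; rewrite tail1// divr1; lra. Qed.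

(** Keep only the masses of the points j + 1, ..., 2 j + 1. *)
Lemma power_law_tail_ge j : 1 / (8 * j.+1%:R) <= tail mu j.+1.
Proof.
rewrite (le_trans _ (tail_partial_sum mu j.+1 j.+1))//.
rewrite (@le_trans _ _ (\sum_(i < j.+1) beta * (2 * j.+1%:R) ^- 2))//.
  rewrite sumr_const card_ord -[leRHS]mulr_natr.
  rewrite (_ : beta * _ * _ = 2 * beta / (8 * j.+1%:R)); last first.
    have : j.+1%:R != 0 :> R by rewrite pnatr_eq0.
    by move: j.+1%:R => x x0; field.
  by rewrite ler_wpM2r ?invr_ge0 ?mulr_ge0//; have := beta_ge; lra.
apply: ler_sum => i _; rewrite muE//= ler_wpM2l// lef_pV2 ?posrE ?exprn_gt0//.
by rewrite -natrM -!natrX ler_nat leq_exp2r//; have := ltn_ord i; lia.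
Qed.

(** Doubling the truncation level adds at least 1 / 16, as for the harmonic
    series. *)
Lemma power_law_trunc_mean_unbounded B : exists M, B <= trunc_mean mu M.
Proof.
have dbl i : i%:R / 16 <= trunc_mean mu (2 ^ i)%N.
  elim: i => [|i IH]; first by rewrite mul0r trunc_mean_ge0.
  have key n : (n <= 2 ^ i)%N ->
      trunc_mean mu (2 ^ i)%N + n%:R / (16 * (2 ^ i)%N%:R) <=
        trunc_mean mu (2 ^ i + n)%N.
    elim: n => [|n IHn] nle; first by rewrite mul0r addr0 addn0.
    rewrite addnS trunc_meanS (le_trans _ (lerD (IHn (ltnW nle))
      (power_law_tail_ge _)))//.
    rewrite -[n.+1%:R]natr1 mulrDl addrA lerD2l mul1r div1r lef_pV2 ?posrE
      ?mulr_gt0 ?ltr0n ?expn_gt0//.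
    by rewrite -!natrM ler_nat; lia.
  have := key _ (leqnn _); rewrite addnn -mul2n -expnS.
  have -> : (2 ^ i)%N%:R / (16 * (2 ^ i)%N%:R) = 1 / 16 :> R.
    have : (2 ^ i)%N%:R != 0 :> R by rewrite pnatr_eq0 -lt0n expn_gt0.
    by move: (2 ^ i)%N%:R => x x0; field.
  by move: IH; rewrite -natr1; lra.
have [n hn] : exists n : nat, B * 16 <= n%:R.
  exists (Num.truncn `|B * 16|).+1.
  by rewrite (le_trans (ler_norm _))// ltW// truncnS_gt.
by exists (2 ^ n)%N; rewrite (le_trans _ (dbl n))//; lra.
Qed.

End PowerLaw.

Lemma b_lim_rec (R : realType) k : (k.+1%:R + 2) * b_lim R k.+1 =
  2 * (beta2 R * k.+1%:R ^- 2) + k%:R * b_lim R k.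
Proof.
rewrite /b_lim [in LHS]big_nat_recr//=.
set s := \sum_(1 <= i < k.+1) _.
have [k0|kn] := eqVneq k 0%N.
  by rewrite /s k0 big_geq// !mul0r add0r addr0 expr1n; field.
have : k%:R != 0 :> R by rewrite pnatr_eq0.
rewrite -natr1.
have : 0 <= k%:R :> R by [].
move: k%:R => x x0 xn; rewrite -exprVn.
by field; rewrite xn !gt_eqF//; lra.
Qed.

(** * Multigraphs up to the order of their edges, and conditioning on them *)

(** The model gives the law of a step conditionally on the multigraph, not on
    the list of its edges, so only such functions can be averaged. *)
Definition perm_invariant {A} (phi : multigraph -> A) :=
  forall g h : multigraph, perm_eq g h -> phi g = phi h.

(** A representative chosen once per multigraph: conditioning on a multigraph is
    then conditioning on the value of a map into a countable type. *)
Definition graph_class (g : multigraph) : multigraph := choose (perm_eq g) g.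

Lemma perm_graph_class g : perm_eq g (graph_class g).
Proof. exact/chooseP/perm_refl. Qed.

Lemma graph_class_invariant : perm_invariant graph_class.
Proof.
move=> g h gh; rewrite /graph_class.
have E : perm_eq g =1 perm_eq h by move=> l; have /permPl := gh; apply.
by rewrite (eq_choose E); apply: choose_id => //; rewrite -E// perm_sym.
Qed.

Lemma graph_class_perm g h : graph_class g = graph_class h -> perm_eq g h.
Proof.
move=> E; apply: (perm_trans (perm_graph_class g)).
by rewrite E perm_sym perm_graph_class.
Qed.

(** The newer endpoint of an edge records its step, so the batch sizes can be
    read off the multigraph. *)
Definition batch (g : multigraph) (s : nat) : nat := count (fun e =>
  e.2 == s) g.

(** What holds almost surely after step t, and makes [attach_prob] a probability
    on v_0, ..., v_t. *)
Definition well_formed (t : nat) (g : multigraph) : bool :=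
  all (fun e => (e.1 <= t) && (e.2 <= t))%N g && (t <= size g)%N.

Lemma well_formed_invariant t : perm_invariant (well_formed t).
Proof.
by move=> g h gh; rewrite /well_formed (perm_all _ gh) (perm_size gh).
Qed.

Lemma degree_invariant v : perm_invariant (degree ^~ v).
Proof. by move=> g h /permP gh; rewrite /degree !gh. Qed.

Lemma size_invariant : perm_invariant (@size (nat * nat)).
Proof. exact: perm_size. Qed.

Lemma batch_invariant s : perm_invariant (batch ^~ s).
Proof. by move=> g h /permP gh; rewrite /batch gh. Qed.

Lemma count_sum_ord (T' : Type) (f : T' -> nat) t (g : seq T') :
  all (fun e => f e <= t)%N g ->
  (\sum_(v < t.+1) count (fun e => f e == v) g = size g)%N.
Proof.
elim: g => [_|e g IH /= /andP[et gt]]; first by rewrite big1.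
rewrite big_split /= IH// -[RHS]add1n; congr (_ + _)%N.
rewrite (bigD1 (Ordinal (et : (f e < t.+1)%N)))//= eqxx big1// => v ve.
case: eqP => // ev; case/eqP: ve; exact/val_inj.
Qed.

Lemma sum_degree t g : well_formed t g ->
  (\sum_(v < t.+1) degree g v = 2 * size g)%N.
Proof.
move=> /andP[/allP wf _]; rewrite big_split /= mul2n -addnn.
by rewrite !count_sum_ord//; apply/allP => e /wf /andP[].
Qed.

Definition attach_batch t n (g : multigraph) (s : {ffun 'I_n -> 'I_t.+1}) :
  multigraph := g ++ [seq (val (s j), t.+1) | j <- enum 'I_n].

Section AttachBatch.
Context {t n : nat} (g : multigraph) (s : {ffun 'I_n -> 'I_t.+1}).
Hypothesis wf : well_formed t g.

Lemma size_attach_batch : size (attach_batch g s) = (size g + n)%N.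
Proof. by rewrite size_cat size_map size_enum_ord. Qed.

Lemma well_formed_attach_batch : (0 < n)%N -> well_formed t.+1 (attach_batch g
  s).
Proof.
move=> n0; move: wf => /andP[wfe wfs].
rewrite /well_formed size_attach_batch all_cat.
apply/andP; split; last by rewrite -addn1 leq_add.
apply/andP; split.
  by apply: sub_all wfe => e /andP[/leqW-> /leqW->].
by apply/allP => _ /mapP[j _ ->] /=; rewrite leqnn andbT ltnW.
Qed.

Lemma degree_attach_batch (v : 'I_t.+1) :
  degree (attach_batch g s) v = (degree g v + hits s v)%N.
Proof.
rewrite /degree !count_cat !count_map.
rewrite [X in (_ + (_ + X))%N](eq_count (a2 := pred0)) => [|j /=]; last first.
  by rewrite gtn_eqF.
rewrite count_pred0 addn0 addnAC; congr (_ + _)%N.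
rewrite -enumT -sum1_count [LHS]big_mkcond big_enum /hits.
by apply: eq_bigr => j _; rewrite -val_eqE /=; case: eqP.
Qed.

Lemma degree_attach_batch_new : degree (attach_batch g s) t.+1 = n.
Proof.
rewrite /degree !count_cat !count_map.
move: wf => /andP[/allP wfe _].
rewrite (eq_in_count (a1 := fun e => e.1 == t.+1) (a2 := pred0)); last first.
  by move=> e /wfe /andP[et _]; rewrite ltn_eqF.
rewrite (eq_in_count (a1 := fun e => e.2 == t.+1) (a2 := pred0)); last first.
  by move=> e /wfe /andP[_ et]; rewrite ltn_eqF.
rewrite !count_pred0 !add0n.
rewrite (eq_count (a2 := pred0)) => [|j /=]; last by rewrite ltn_eqF.
rewrite count_pred0 add0n (eq_count (a2 := predT)) => [|j /=];
  last by rewrite eqxx.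
by rewrite count_predT -enumT size_enum_ord.
Qed.

End AttachBatch.

Section Pathwise.
Variables (x : nat -> nat) (c : nat -> nat -> nat).

Lemma pa_graphS t : (0 < t)%N -> pa_graph x c t.+1 =
  pa_graph x c t ++ [seq (c t.+1 j, t.+1) | j <- iota 0 (x t.+1)].
Proof. by case: t. Qed.

Lemma batch_pa_graph t s : (0 < s)%N ->
  batch (pa_graph x c t) s = if (s <= t)%N then x s else 0%N.
Proof.
move=> s0; elim: t => [|t IH]; first by rewrite leqNgt s0.
case: t IH => [_|t IH].
  rewrite /= /batch count_nseq /=; case: s s0 => [|[|s]]//= _.
  by rewrite mul1n.
rewrite pa_graphS// /batch count_cat -/(batch _ _) IH count_map.
have [st|st|->] := ltngtP s t.+2.
- rewrite -ltnS st (eq_count (a2 := pred0)) ?count_pred0 ?addn0// => j /=.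
  by rewrite gtn_eqF.
- rewrite leqNgt (ltnW st) (eq_count (a2 := pred0)) ?count_pred0 ?addn0//= => j
  /=.
  by rewrite ltn_eqF.
rewrite ltnn (eq_count (a2 := predT)) ?count_predT ?size_iota// => j /=.
by rewrite eqxx.
Qed.

Lemma size_pa_graph t : size (pa_graph x c t) = (\sum_(s < t) x s.+1)%N.
Proof.
elim: t => [|[|t] IH]; first by rewrite big_ord0.
  by rewrite big_ord_recr big_ord0 /= size_nseq.
by rewrite pa_graphS// size_cat size_map size_iota IH [RHS]big_ord_recr.
Qed.

End Pathwise.

Section Conditioning.
Context {d} {T : measurableType d} {R : realType} (P : probability T R).
Context (mu : probability nat R).
Context (Xs : nat -> {RV P >-> nat}) (C : nat -> nat -> {RV P >-> nat}).
Hypothesis model : parid mu Xs C.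

Let G (t : nat) (w : T) : multigraph := parid_graph Xs C t w.

Lemma discrete_endpoints t n : discrete_map (fun w => mkseq (fun j =>
  C t j w) n).
Proof.
elim: n => [|n IH].
  exact: (@discrete_comp _ _ _ _ (fun=> [::]) _ (discrete_mfun (C 0 0))).
have := discrete_comp (fun p => rcons p.1 p.2)
  (discrete_pair IH (discrete_mfun (C t n))).
by rewrite /mkseq -addn1 iotaD;
  under [X in _ -> discrete_map X]eq_fun do rewrite map_cat cats1.
Qed.

Lemma discrete_graph t : discrete_map (G t).
Proof.
elim: t => [|[|t] IH].
- exact: (@discrete_comp _ _ _ _ (fun=> [::]) _ (discrete_mfun (Xs 0))).
- exact: (@discrete_comp _ _ _ _ (fun n =>
  nseq n (0%N, 1%N)) _ (discrete_mfun (Xs 1))).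
have dB : discrete_map (fun w => mkseq (fun j => C t.+2 j w) (Xs t.+2 w)).
  move=> l; rewrite (_ : _ @^-1` _ = Xs t.+2 @^-1` [set size l] `&`
      (fun w => mkseq (fun j => C t.+2 j w) (size l)) @^-1` [set l]).
    apply: measurableI; first exact: discrete_mfun.
    exact: discrete_endpoints.
  apply/seteqP; split=> w /= => [<-|[-> //]].
  by rewrite size_mkseq.
have := discrete_comp (fun p => p.1 ++ [seq (i, t.+2) | i <- p.2])
  (discrete_pair IH dB).
congr discrete_map; apply/funext => w.
by rewrite /G /parid_graph pa_graphS// -/(G _ _) /comp -(map_comp (fun i =>
  (i, t.+2))).
Qed.

Lemma discrete_state t : discrete_map (fun w => (G t w, Xs t.+1 w)).
Proof. exact: discrete_pair (discrete_graph t) (discrete_mfun _). Qed.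

Let event_graph t g := [set w | perm_eq (G t w) g].

Let measurable_event_graph t g : measurable (event_graph t g).
Proof. exact: (discrete_preimage [set h | perm_eq h g] (discrete_graph t)). Qed.

Let class_cell t g : graph_class g = g ->
  (graph_class \o G t) @^-1` [set g] = event_graph t g.
Proof.
move=> gg; apply/seteqP; split=> w /=.
  by rewrite -{1}gg => /graph_class_perm.
by move=> /graph_class_invariant ->.
Qed.

Let class_cell0 t g : graph_class g <> g ->
  (graph_class \o G t) @^-1` [set g] = set0.
Proof.
move=> gg; apply/seteqP; split=> // w /= E; apply: gg.
by rewrite -{1}E -(graph_class_invariant (perm_graph_class _)).
Qed.

Definition ae_well_formed t := P [set w | ~~ well_formed t (G t w)] = 0%E.

Let event_graph_null t g : ae_well_formed t -> ~~ well_formed t g ->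
  P (event_graph t g) = 0%E.
Proof.
move=> wf ng; apply/eqP; rewrite -measure_le0 -wf; apply: le_measure.
- by rewrite inE.
- rewrite inE.
  exact: (discrete_preimage [set h | ~~ well_formed t h] (discrete_graph t)).
- by move=> w /= /well_formed_invariant ->.
Qed.

(** Given the current multigraph, the size of the next batch is a fresh variable
    of law mu. *)
Lemma average_batch t (q : multigraph -> nat -> R) (H : multigraph -> R) B :
  (0 < t)%N -> ae_well_formed t ->
  (forall n, perm_invariant (q ^~ n)) -> perm_invariant H ->
  (forall g n, `|q g n| <= B) -> (forall g, `|H g| <= B) ->
  (forall g, well_formed t g -> \int[mu]_n q g n <= H g) ->
  \int[P]_w q (G t w) (Xs t.+1 w) <= \int[P]_w H (G t w).
Proof.
move=> t0 wf qinv Hinv qB HB qH.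
apply: (@cells_le _ _ _ _ _ (graph_class \o G t)).
- exact/discrete_comp/discrete_graph.
- apply: (@bounded_measurable_comp _ _ _ _ (fun w =>
  (G t w, Xs t.+1 w)) (fun p => q p.1 p.2) B) => //.
  exact: discrete_state.
- by apply: (@bounded_measurable_comp _ _ _ _ (G t) H B) => //;
  exact: discrete_graph.
move=> g; have [gg|gg] := pselect (graph_class g = g); last first.
  by rewrite class_cell0// !Rintegral_set0.
rewrite class_cell//.
have -> : \int[P]_(w in event_graph t g) q (G t w) (Xs t.+1 w) =
    \int[P]_(w in event_graph t g) q g (Xs t.+1 w).
  by apply: eq_Rintegral => w /set_mem /= Gg; exact: qinv.
have -> : \int[P]_(w in event_graph t g) H (G t w) =
    fine (P (event_graph t g)) * H g.
  rewrite mulrC -Rintegral_cst//.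
  by apply: eq_Rintegral => w /set_mem /= Gg; exact: Hinv.
rewrite (Rintegral_indep_cell (mu := mu) (B := B))//; last first.
  move=> n; rewrite /event_graph (parid_fresh model)//; congr *%E.
  exact: (parid_law model).
have [wg|ng] := boolP (well_formed t g).
  by rewrite ler_wpM2l ?fine_ge0 ?qH.
by rewrite event_graph_null//= !mul0r.
Qed.

Let endpoint_event t n (s : {ffun 'I_n -> 'I_t.+1}) : set T :=
  [set w | forall j : 'I_n, C t.+1 j w = s j].

Let measurable_endpoint_event t n (s : {ffun 'I_n -> 'I_t.+1}) :
  measurable (endpoint_event s).
Proof.
rewrite (_ : endpoint_event s = \bigcap_(j in [set: 'I_n]) C t.+1 j @^-1` [set
  val (s j)]).
  by apply: fin_bigcap_measurable => // j _; exact: discrete_mfun.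
by apply/seteqP; split=> w h j; [move=> _; exact: h|exact: h].
Qed.

Let endpoint_prob t n g (s : {ffun 'I_n -> 'I_t.+1}) : (0 < t)%N ->
  (P (event_graph t g `&` Xs t.+1 @^-1` [set n] `&` endpoint_event s) =
   P (event_graph t g `&` Xs t.+1 @^-1` [set n]) *
     (\prod_(j < n) attach_prob R g (s j))%:E)%E.
Proof.
move=> t0.
pose i (j : nat) : nat := if insub j is Some j' then s j' else 0%N.
have iE (j : 'I_n) : i j = s j by rewrite /i valK.
have -> : endpoint_event s = [set w | forall j, (j < n)%N -> C t.+1 j w = i j].
  apply/seteqP; split=> w /= h j => [jn|].
    by rewrite (h (Ordinal jn)) -iE.
  by rewrite h.
rewrite (parid_attach model)//; last first.
  by move=> j jn; rewrite (iE (Ordinal jn)) -ltnS.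
by under eq_bigr do rewrite iE.
Qed.

Let next_graph t n g (s : {ffun 'I_n -> 'I_t.+1}) w : (0 < t)%N ->
  event_graph t g w -> Xs t.+1 w = n -> endpoint_event s w ->
  perm_eq (G t.+1 w) (attach_batch g s).
Proof.
move=> t0 gw Xw sw; rewrite /G /parid_graph pa_graphS//.
rewrite /attach_batch; apply: perm_cat => //.
rewrite Xw -val_enum_ord -map_comp (_ : map _ _ = map (fun j =>
  (val (s j), t.+1)) (enum 'I_n)) //.
by apply: eq_map => j /=; rewrite sw.
Qed.

(** Given the current multigraph and the size n of the next batch, the new
    endpoints are n independent draws.  The draws among existing vertices
    already have total probability 1, so no other endpoint matters. *)
Lemma average_attachment t (phi : multigraph -> R) (q : multigraph -> nat -> R)
  B :
  (0 < t)%N -> ae_well_formed t ->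
  perm_invariant phi -> (forall n, perm_invariant (q ^~ n)) ->
  (forall g, `|phi g| <= B) -> (forall g n, `|q g n| <= B) ->
  (forall g n, well_formed t g ->
    sampleE (fun v : 'I_t.+1 => attach_prob R g v)
      (fun s : {ffun 'I_n -> 'I_t.+1} => phi (attach_batch g s)) <= q g n) ->
  \int[P]_w phi (G t.+1 w) <= \int[P]_w q (G t w) (Xs t.+1 w).
Proof.
move=> t0 wf pinv qinv pB qB pq.
have bphi : bounded_measurable (fun w => phi (G t.+1 w)).
  by apply: (@bounded_measurable_comp _ _ _ _ (G t.+1) phi B) => //;
    exact: discrete_graph.
apply: (@cells_le _ _ _ _ _ (fun w => (graph_class (G t w), Xs t.+1 w))).
- apply: discrete_pair; last exact: discrete_mfun.
  exact/discrete_comp/discrete_graph.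
- exact: bphi.
- apply: (@bounded_measurable_comp _ _ _ _ (fun w =>
  (G t w, Xs t.+1 w)) (fun p => q p.1 p.2) B) => //.
  exact: discrete_state.
move=> [g n].
have -> : (fun w => (graph_class (G t w), Xs t.+1 w)) @^-1` [set (g, n)] =
    (graph_class \o G t) @^-1` [set g] `&` Xs t.+1 @^-1` [set n].
  by apply/seteqP; split=> w /= [-> ->].
have [gg|gg] := pselect (graph_class g = g); last first.
  by rewrite class_cell0// set0I !Rintegral_set0.
rewrite class_cell//; set A := _ `&` _.
have mX : measurable (Xs t.+1 @^-1` [set n]) by exact: discrete_mfun.
have mA : measurable A by exact: measurableI.
have -> : \int[P]_(w in A) q (G t w) (Xs t.+1 w) = fine (P A) * q g n.
  rewrite mulrC -Rintegral_cst//; apply: eq_Rintegral => w /set_mem [Gg /= ->].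
  exact: qinv.
have [wg|ng] := boolP (well_formed t g); last first.
  have A0 : P A = 0%E.
    apply/eqP; rewrite -measure_le0 -(event_graph_null wf ng).
    by apply: le_measure; rewrite ?inE//; exact: subIsetl.
  by rewrite [P A]A0 /= mul0r Rintegral_null//; case: bphi.
have degL := sum_degree wg.
have g0 : (0 < size g)%N by case/andP: wg => _; exact: leq_trans.
pose F (s : {ffun 'I_n -> 'I_t.+1}) := A `&` endpoint_event s.
have mF s : measurable (F s) by exact: measurableI.
have tF : trivIset [set` index_enum {ffun 'I_n -> 'I_t.+1}] F.
  apply/trivIsetP => s s' _ _ /eqP ss'; apply/seteqP;
    split=> // w [[_ ws] [_ ws']].
  by apply: ss'; apply/ffunP => j; apply/val_inj;
    exact: (etrans (esym (ws j)) (ws' j)).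
pose U := \big[setU/set0]_s F s.
have mU : measurable U by exact: bigsetU_measurable.
have UA : U `<=` A.
  rewrite /U -bigcup_seq => w [s _ []]//.
have PF s : P (F s) = (P A * (\prod_(j < n) attach_prob R g (s j))%:E)%E.
  exact: endpoint_prob.
have PAfin : P A \is a fin_num by exact: fin_num_measure.
have PU : P U = P A.
  rewrite -[LHS]mul1e -integral_cst// /U integral_bigsetU_EFin//; last first.
  - exact: measurable_cst.
  - exact: index_enum_uniq.
  under eq_bigr do rewrite integral_cst// mul1e.
  rewrite (eq_bigr _ (fun s _ => PF s)) -(fineK PAfin).
  under eq_bigr do rewrite -EFinM.
  rewrite sumEFin -big_distrr /=; congr EFin.
  rewrite -[RHS]mulr1; congr (_ * _).
  rewrite -[RHS](sampleE_cst (a := fun v : 'I_t.+1 => attach_prob R g v) _ n).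
    by apply: eq_bigr => s _; rewrite mulr1.
  exact: (sum_degree_weight g0 degL).
have PN : P (A `\` U) = 0%E.
  by rewrite measureD ?(setIidr UA) ?ltey_eq ?PAfin// [X in (_ - X)%E]PU subee.
have iA : P.-integrable A (EFin \o (fun w => phi (G t.+1 w))).
  exact: bounded_measurable_integrable.
have -> : \int[P]_(w in A) phi (G t.+1 w) = \int[P]_(w in U) phi (G t.+1 w).
  rewrite /Rintegral (negligible_integral (N := A `\` U))//;
    last exact: measurableD.
  by rewrite setDD (setIidr UA).
have -> : \int[P]_(w in U) phi (G t.+1 w) =
    \sum_s fine (P (F s)) * phi (attach_batch g s).
  rewrite /Rintegral /U integral_bigsetU_EFin//; last first.
  - apply/measurable_EFinP; apply: measurable_funS bphi.1 => //.
  - exact: index_enum_uniq.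
  rewrite -sum_fine => [|s _]; last first.
    apply: (@integrable_fin_num _ _ _ P _ _ (EFin \o (fun w =>
      phi (G t.+1 w)))) => //.
    exact: bounded_measurable_integrable.
  apply: eq_bigr => s _; rewrite mulrC -[LHS]/(Rintegral P (F s) _)
    -Rintegral_cst//.
  apply: eq_Rintegral => w /set_mem [[Aw Xw] ws]; apply: pinv.
  exact: next_graph.
rewrite (eq_bigr (fun s : {ffun 'I_n -> 'I_t.+1} => fine (P A) *
    ((\prod_(j < n) attach_prob R g (s j)) * phi (attach_batch g s))));
      last first.
  by move=> s _; rewrite PF mulrA fineM.
rewrite -big_distrr /= ler_wpM2l ?fine_ge0//.
exact: pq.
Qed.

End Conditioning.

(** * Growth of the number of edges *)

Lemma normr_sqr_le (R : realType) (x y : R) : `|x| <= y -> `|x ^+ 2| <= y ^+ 2.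
Proof.
by move=> h; rewrite normrX ler_pXn2r// nnegrE// (le_trans _ h).
Qed.

Section TruncatedSize.
Context {R : realType}.

(** The number of edges if each batch were cut at M. *)
Definition trunc_size (M t : nat) (g : multigraph) : nat :=
  (\sum_(s < t) minn (batch g s.+1) M)%N.

Lemma trunc_size_invariant M t : perm_invariant (trunc_size M t).
Proof.
by move=> g h gh; apply: eq_bigr => s _;
  rewrite (batch_invariant _ gh).
Qed.

Lemma trunc_size_le M t g : (trunc_size M t g <= t * M)%N.
Proof.
rewrite (@leq_trans (\sum_(s < t) M))%N//;
  last by rewrite sum_nat_const card_ord.
by apply: leq_sum => s _; exact: geq_minr.
Qed.

(** The pathwise comparison behind the law of large numbers: Lam is the number
    of edges, y1 and y2 its truncations at a low and a high level, N the number
    of batches above the high level.  A small Lam makes y1 small; the ratio is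
    then at most m, which the square of 1 - y1 / tau has to compensate.  A large
    Lam is seen by y2 unless N is positive. *)
Lemma inverse_ratio_bound (m tau Lam y1 y2 N : R) :
  1 <= m -> 0 < tau -> 0 < Lam -> tau / Lam <= m -> y1 <= Lam ->
  (N = 0 /\ y2 = Lam) \/ 1 <= N ->
  `|tau / Lam - 1| <=
    5 * m * (1 - y1 / tau) ^+ 2 + m^-1 + N + `|y2 / tau - 1|.
Proof.
move=> m1 tau0 Lam0 hm y1L hN.
have m0 : 0 < m by lra.
have i0 : 0 < m^-1 by rewrite invr_gt0.
have im : m * m^-1 = 1 by rewrite divff// gt_eqF.
pose x := y1 / tau.
have xL : x <= Lam / tau by rewrite ler_wpM2r// invr_ge0 ltW.
rewrite -/x; pose z := Lam / tau.
have z0 : 0 < z by rewrite divr_gt0.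
have -> : tau / Lam = z^-1 by rewrite /z invf_div.
have hzm : z^-1 <= m by rewrite /z invf_div.
have iz0 : 0 < z^-1 by rewrite invr_gt0.
have izz : z * z^-1 = 1 by rewrite divff// gt_eqF.
have N0 : 0 <= N by case: hN => [[->]|]//; lra.
have sq : 0 <= m * (1 - x) ^+ 2 by rewrite mulr_ge0 ?sqr_ge0 ?ltW.
have abs0 : 0 <= `|y2 / tau - 1| by [].
rewrite -/z in xL.
have [z1|z1] := leP 1 z.
  have iz1 : z^-1 <= 1 by rewrite invf_le1.
  rewrite ler0_norm ?subr_le0//.
  case: hN => [[_ ->]|N1]; last by lra.
  rewrite -/z ger0_norm ?subr_ge0//; nra.
have iz1 : 1 <= z^-1 by rewrite invf_ge1// ltW.
rewrite ger0_norm ?subr_ge0//.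
have [z2|z2] := leP (1 / 2) z.
  have h1 : z^-1 - 1 <= 2 * (1 - x) by nra.
  have h2 : 2 * (1 - x) <= m * (1 - x) ^+ 2 + m^-1.
    have : 0 <= m * ((1 - x) - m^-1) ^+ 2 by rewrite mulr_ge0 ?sqr_ge0 ?ltW.
    rewrite (_ : _ * _ = m * (1 - x) ^+ 2 - 2 * (m * m^-1) * (1 - x) +
      m * m^-1 * m^-1); last by ring.
    by rewrite im; lra.
  lra.
have h3 : 1 <= 4 * (1 - x) ^+ 2 by nra.
have h4 : m <= m * (4 * (1 - x) ^+ 2) by rewrite ler_peMr// ltW.
lra.
Qed.

End TruncatedSize.

Section EdgeGrowth.
Context {d} {T : measurableType d} {R : realType} (P : probability T R).
Context (mu : probability nat R).
Context (Xs : nat -> {RV P >-> nat}) (C : nat -> nat -> {RV P >-> nat}).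
Hypothesis model : parid mu Xs C.

Let G (t : nat) (w : T) : multigraph := parid_graph Xs C t w.
Let mu0 : mu [set 0%N] = 0%E := parid_pos model.

Lemma bounded_measurable_graph t (phi : multigraph -> R) B :
  (forall g, `|phi g| <= B) -> bounded_measurable (fun w => phi (G t w)).
Proof.
move=> hB; apply: (@bounded_measurable_comp _ _ _ _ (G t) phi B) => //.
exact: discrete_graph.
Qed.

Lemma Ex_next_batch t (psi : nat -> R) B : (0 < t)%N ->
  (forall n, `|psi n| <= B) -> \int[P]_w psi (Xs t w) = \int[mu]_n psi n.
Proof.
move=> t0 hB.
rewrite (Rintegral_indep_cell (mu := mu) (B := B))//.
  by rewrite [X in fine X](_ : _ = 1%E) ?mul1r//; exact: probability_setT.
move=> n; rewrite [X in (X * _)%E](_ : _ = 1%E) ?mul1e;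
  last exact: probability_setT.
by rewrite setTI; exact: (parid_law model).
Qed.

Lemma positive_batch_ae t : (0 < t)%N -> P [set w | Xs t w == 0%N] = 0%E.
Proof.
move=> t0; rewrite -mu0 -(parid_law model t0)//; congr (P _).
by apply/seteqP; split=> w /= /eqP.
Qed.

Lemma graph_ae_well_formed t : (0 < t)%N -> ae_well_formed Xs C t.
Proof.
elim: t => // -[_ _|t IH _].
  rewrite /ae_well_formed -(positive_batch_ae (t := 1))//; congr (P _).
  apply/funext => w; apply/propext; rewrite /= /parid_graph /well_formed /=.
  by rewrite size_nseq all_nseq /= orbT -eqn0Ngt.
have wf := IH isT.
have p01 (b : bool) : `|b%:R| <= 1 :> R by case: b; rewrite ?normr1 ?normr0.
have h : \int[P]_w (~~ well_formed t.+2 (G t.+2 w))%:R <=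
    \int[P]_w (Xs t.+2 w == 0%N)%:R.
  apply: (@average_attachment _ _ _ P mu Xs C model t.+1
    (fun g => (~~ well_formed t.+2 g)%:R) (fun _ n => (n == 0%N)%:R) 1) => //.
    by move=> g h gh; rewrite (well_formed_invariant _ gh).
  move=> g n wg; rewrite -[leRHS](sampleE_cst (a := fun v : 'I_t.+2 =>
    attach_prob R g v) _ n).
    apply: sampleE_le => [v|s]; first by rewrite divr_ge0.
    case: n s => [|n] s; first by rewrite eqxx; case: (well_formed _ _).
    by rewrite well_formed_attach_batch.
  apply: (sum_degree_weight _ (sum_degree wg)).
  by case/andP: wg => _; exact: leq_trans.
rewrite (Ex_next_batch (psi := fun n => (n == 0%N)%:R) (B := 1))// in h.
rewrite Ex_point mu0 /= in h.
have mN : measurable [set w | ~~ well_formed t.+2 (G t.+2 w)].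
  exact: (discrete_preimage [set h | ~~ well_formed t.+2 h] (discrete_graph Xs
    C t.+2)).
rewrite /ae_well_formed -[LHS]fineK ?fin_num_measure//; congr EFin.
apply/eqP; rewrite eq_le fine_ge0 ?andbT//.
rewrite (le_trans _ h)// -Ex_indic// le_eqVlt; apply/orP; left; apply/eqP.
apply: eq_Rintegral => w _; rewrite indicE; congr (nat_of_bool _)%:R.
by apply/idP/idP => [/set_mem//|]; rewrite in_setE.
Qed.

Section TailBound.
Variable c : R.
Hypothesis tail_le : forall j, tail mu j.+1 <= c / j.+1%:R.
Let c0 : 0 <= c := tail_cst_ge0 tail_le.
Let m := trunc_mean mu.

Let batch_graph t s w : (s < t)%N -> batch (G t w) s.+1 = Xs s.+1 w.
Proof. by move=> st; rewrite /G /parid_graph batch_pa_graph// st. Qed.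

Let trunc_size_graph M t w :
  trunc_size M t (G t w) = (\sum_(s < t) minn (Xs s.+1 w) M)%N.
Proof. by apply: eq_bigr => s _; rewrite batch_graph. Qed.

Let size_graph t w : size (G t w) = (\sum_(s < t) Xs s.+1 w)%N.
Proof. exact: size_pa_graph. Qed.

Let trunc_dev M t (g : multigraph) : R := (trunc_size M t g)%:R - t%:R * m M.

Let trunc_dev_bound M t g : `|trunc_dev M t g| <= t%:R * M%:R.
Proof.
have : (trunc_size M t g)%:R <= t%:R * M%:R :> R
  by rewrite -natrM ler_nat trunc_size_le.
have : 0 <= (trunc_size M t g)%:R :> R by [].
have : t%:R * m M <= t%:R * M%:R by rewrite ler_wpM2l// trunc_mean_le.
have : 0 <= t%:R * m M by rewrite mulr_ge0// trunc_mean_ge0.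
rewrite /trunc_dev ler_norml; lra.
Qed.

(** Each new batch is independent of the past and adds at most the second moment
    of the truncated law.  The first batch is merely bounded by M, which is
    enough when M is a multiple of t. *)
Lemma trunc_size_variance M t : (0 < t)%N ->
  \int[P]_w (trunc_dev M t (G t w) ^+ 2) <= M%:R ^+ 2 + 2 * c * M%:R * t%:R.
Proof.
elim: t => // -[_ _|t IH _].
  rewrite (@le_trans _ _ (M%:R ^+ 2))//; last by rewrite lerDl !mulr_ge0.
  rewrite -[leRHS](Ex_cst P); apply: Ex_le.
  - apply: (@bounded_measurable_graph 1 (fun g =>
    trunc_dev M 1 g ^+ 2) ((1 * M%:R)^+2)).
    by move=> g; apply: normr_sqr_le; exact: trunc_dev_bound.
  - exact: bounded_measurable_cst.
  - move=> w; rewrite (le_trans (ler_norm _))// normr_sqr_le//.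
    by rewrite (le_trans (trunc_dev_bound _ _ _))// mul1r.
have wf : ae_well_formed Xs C t.+1 by exact: graph_ae_well_formed.
pose q g n : R := (trunc_dev M t.+1 g + ((minn n M)%:R - m M)) ^+ 2.
pose H g : R := trunc_dev M t.+1 g ^+ 2 + 2 * c * M%:R.
have minM n : 0 <= ((minn n M)%:R : R) <= M%:R
  by rewrite ler0n ler_nat geq_minr.
have mM : 0 <= m M <= M%:R by rewrite trunc_mean_ge0 trunc_mean_le.
have devM n : `|(minn n M)%:R - m M| <= M%:R :> R.
  by have /andP[? ?] := minM n; have /andP[? ?] := mM; rewrite ler_norml; lra.
have inv : perm_invariant (trunc_dev M t.+1).
  by move=> g h gh; rewrite /trunc_dev (trunc_size_invariant _ _ gh).
pose B := (t.+1%:R * M%:R + M%:R) ^+ 2 + 2 * c * M%:R : R.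
have cM0 : 0 <= 2 * c * M%:R by rewrite !mulr_ge0.
have qB g n : `|q g n| <= B.
  rewrite (@le_trans _ _ ((t.+1%:R * M%:R + M%:R) ^+ 2))// ?lerDl//.
  by rewrite normr_sqr_le// (le_trans (ler_normD _ _))// lerD ?trunc_dev_bound.
have HB g : `|H g| <= B.
  rewrite (le_trans (ler_normD _ _))// (ger0_norm cM0) lerD2r.
  by rewrite normr_sqr_le// (le_trans (trunc_dev_bound _ _ _))// lerDl.
have -> : \int[P]_w (trunc_dev M t.+2 (G t.+2 w) ^+ 2) =
    \int[P]_w q (G t.+1 w) (Xs t.+2 w).
  apply: eq_Rintegral => w _; rewrite /q; congr (_ ^+ 2).
  rewrite /trunc_dev !trunc_size_graph big_ord_recr/= natrD -[t.+2%:R]natr1.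
  by ring.
apply: (@le_trans _ _ (\int[P]_w H (G t.+1 w))).
apply: (@average_batch _ _ _ P mu Xs C model t.+1 q H B) => //.
- by move=> n g g' gg'; rewrite /q (inv _ _ gg').
- by move=> g g' gg'; rewrite /H (inv _ _ gg').
- move=> g _; rewrite /q /H.
  set y := trunc_dev _ _ _.
  have bmin : bounded_measurable (fun n => (minn n M)%:R : R).
    by apply: (@bounded_measurable_nat _ _ M%:R) => n; rewrite ger0_norm;
      case/andP: (minM n).
  have bmin2 : bounded_measurable (fun n => (minn n M)%:R ^+ 2 : R).
    apply: (@bounded_measurable_nat _ _ (M%:R ^+ 2)) => n.
    by apply: normr_sqr_le; rewrite ger0_norm; case/andP: (minM n).
  have -> : \int[mu]_n (y + ((minn n M)%:R - m M)) ^+ 2 =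
      \int[mu]_n ((minn n M)%:R ^+ 2 +
        (2 * (y - m M) * (minn n M)%:R + (y - m M) ^+ 2)).
    by apply: eq_Rintegral => n _; ring.
  rewrite ExD//; last first.
    by apply: bounded_measurableD;
      [exact: bounded_measurableZ|exact: bounded_measurable_cst].
  rewrite ExD; [|exact: bounded_measurableZ|exact: bounded_measurable_cst].
  rewrite ExZ// Ex_cst Ex_minn -/(m M).
  have := Ex_minn_sqr tail_le M; nra.
rewrite ExD; last exact: bounded_measurable_cst; last first.
  apply: (@bounded_measurable_graph t.+1 (fun g =>
    trunc_dev M t.+1 g ^+ 2) ((t.+1%:R * M%:R)^+2)).
  by move=> g; apply: normr_sqr_le; exact: trunc_dev_bound.
rewrite Ex_cst; have := IH isT; rewrite -[t.+2%:R]natr1; lra.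
Qed.

Definition large_batches (K t : nat) (w : T) : R :=
  \sum_(s < t) (K < Xs s.+1 w)%N%:R.

Lemma bool_batch_bounded K s : bounded_measurable (fun w =>
  (K < Xs s w)%N%:R : R).
Proof.
apply: (@bounded_measurable_comp _ _ _ _ (Xs s) (fun n => (K < n)%N%:R) 1).
  exact: discrete_mfun.
by move=> w; case: (_ < _)%N; rewrite ?normr1 ?normr0.
Qed.

Lemma Ex_large_batches K t : (0 < K)%N ->
  \int[P]_w large_batches K t w <= t%:R * c / K%:R.
Proof.
move=> K0; rewrite Ex_sum => [|s]; last exact: bool_batch_bounded.
rewrite (@le_trans _ _ (\sum_(s < t) c / K%:R))//; last first.
  by rewrite sumr_const card_ord -[leLHS]mulr_natl mulrA.
apply: ler_sum => s _.
rewrite (Ex_next_batch (psi := fun n => (K < n)%N%:R) (B := 1))//.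
  rewrite Ex_tail (le_trans (tail_le _))// ler_wpM2l// lef_pV2 ?posrE ?ltr0n//.
  by rewrite ler_nat.
by move=> n; case: (_ < _)%N; rewrite ?normr1 ?normr0.
Qed.

Let bounded_inverse_size t (x : R) : 0 <= x ->
  bounded_measurable (fun w => `|x / (size (G t w))%:R - 1|).
Proof.
move=> x0.
apply: (@bounded_measurable_graph t (fun g =>
  `|x / (size g)%:R - 1|) (x + 1)) => g.
rewrite normr_id (le_trans (ler_normB _ _))// normr1 lerD2r.
rewrite ger0_norm; last by rewrite divr_ge0.
case: (size g) => [|n]; first by rewrite invr0 mulr0.
by rewrite ler_pdivrMr ?ltr0n// ler_peMr ?ler1n.
Qed.

(** [inverse_ratio_bound] with the truncation levels t and t * L.  The two
    variances are O(t^2), hence contribute O(1 / m t); the last term is the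
    expected number of batches larger than t * L. *)
Lemma inverse_size_lln t L : (0 < t)%N -> (0 < L)%N ->
  \int[P]_w `|t%:R * m t / (size (G t w))%:R - 1| <=
  (7 + 10 * c + (L%:R + 2 * c) * L%:R + c * L%:R) / m t + c / L%:R.
Proof.
move=> t0 L0; have m1 : 1 <= m t by exact: trunc_mean_ge1.
have m0 : 0 < m t by lra.
have tR : 0 < t%:R :> R by rewrite ltr0n.
set M := m t in m1 m0 *; pose tau := t%:R * M.
have tau0 : 0 < tau by rewrite mulr_gt0.
have K0 : (0 < t * L)%N by rewrite muln_gt0 t0.
pose dev M' w := trunc_dev M' t (G t w) ^+ 2.
have bdev M' : bounded_measurable (dev M').
  apply: (@bounded_measurable_graph t (fun g => trunc_dev M' t g ^+ 2)
    ((t%:R * M'%:R) ^+ 2)) => g.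
  by apply: normr_sqr_le; exact: trunc_dev_bound.
have bN : bounded_measurable (large_batches (t * L) t).
  by apply: bounded_measurable_sum => s; exact: bool_batch_bounded.
have bL : bounded_measurable (fun w => `|tau / (size (G t w))%:R - 1|).
  by apply: bounded_inverse_size; exact: ltW.
pose rhs w := (5 / (M * t%:R ^+ 2) * dev t w + large_batches (t * L) t w) +
  (1 / (2 * M * t%:R ^+ 2) * dev (t * L)%N w + (3 / 2 + c * L%:R) / M).
apply: (@le_trans _ _ (\int[P]_w rhs w)).
  have wf := graph_ae_well_formed t0.
  apply: (Ex_le_ae _ wf) => //.
  - exact: (discrete_preimage [set h | ~~ well_formed t h] (discrete_graph Xs C
    t)).
  - apply: bounded_measurableD; apply: bounded_measurableD => //.
    + exact: bounded_measurableZ.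
    + exact: bounded_measurableZ.
    + exact: bounded_measurable_cst.
  move=> w /negP; rewrite negbK => /andP[_ tsize].
  have s0 : 0 < (size (G t w))%:R :> R by rewrite ltr0n (leq_trans t0).
  have tsR : t%:R <= (size (G t w))%:R :> R by rewrite ler_nat.
  pose y1 : R := (trunc_size t t (G t w))%:R.
  pose y2 : R := (trunc_size (t * L) t (G t w))%:R.
  have y1L : y1 <= (size (G t w))%:R.
    rewrite ler_nat trunc_size_graph size_graph; apply: leq_sum => s _.
    exact: geq_minl.
  have hN : (large_batches (t * L) t w = 0 /\ y2 = (size (G t w))%:R) \/
      1 <= large_batches (t * L) t w.
    have [/existsP[s hs]|/existsPn hs] :=
        boolP [exists s : 'I_t, (t * L < Xs s.+1 w)%N].
      right; rewrite /large_batches (bigD1 s)//= hs lerDl.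
      by apply: sumr_ge0.
    left; split.
      by apply: big1 => s _; rewrite (negPf (hs s)).
    rewrite /y2 trunc_size_graph size_graph; congr _%:R; apply: eq_bigr => s _.
    by apply/minn_idPl; rewrite leqNgt.
  have hm : tau / (size (G t w))%:R <= M.
    by rewrite ler_pdivrMr// /tau mulrC ler_wpM2l// ltW.
  apply: (le_trans (inverse_ratio_bound m1 tau0 s0 hm y1L hN)).
  have e1 : 5 * M * (1 - y1 / tau) ^+ 2 = 5 / (M * t%:R ^+ 2) * dev t w.
    by rewrite /dev /trunc_dev -/y1 -/M /tau; field; rewrite !gt_eqF.
  pose x2 := trunc_dev (t * L) t (G t w) / tau.
  have e2 : 1 / (2 * M * t%:R ^+ 2) * dev (t * L)%N w = M * x2 ^+ 2 / 2.
    by rewrite /x2 /dev /tau; field; rewrite !gt_eqF.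
  have i0 : 0 < M^-1 by rewrite invr_gt0.
  have im : M * M^-1 = 1 by rewrite divff// gt_eqF.
  have h2 : `|y2 / tau - 1| <= `|x2| + c * L%:R / M.
    rewrite (_ : y2 / tau - 1 = x2 + (m (t * L)%N - M) / M); last first.
      by rewrite /x2 /trunc_dev -/y2 /tau; field; rewrite !gt_eqF.
    rewrite (le_trans (ler_normD _ _))// lerD2l ger0_norm; last first.
      by rewrite divr_ge0 ?(ltW m0)// subr_ge0 trunc_mean_mono// leq_pmulr.
    rewrite ler_pM2r// lerBlDl; exact: trunc_mean_mul.
  have h3 : `|x2| <= M * x2 ^+ 2 / 2 + M^-1 / 2.
    have -> : x2 ^+ 2 = `|x2| ^+ 2 by rewrite real_normK ?num_real.
    have : 0 <= M * (`|x2| - M^-1) ^+ 2 by rewrite mulr_ge0 ?sqr_ge0 ?ltW.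
    rewrite (_ : _ * _ = M * `|x2| ^+ 2 - 2 * (M * M^-1) * `|x2| +
      M * M^-1 * M^-1); last by ring.
    by rewrite im; lra.
  rewrite /rhs e1 e2 [(3 / 2 + _) / M]mulrDl.
  have : 3 / 2 / M = M^-1 + M^-1 / 2 by field; rewrite gt_eqF.
  lra.
rewrite /rhs ExD; last 2 first.
- by apply: bounded_measurableD => //; exact: bounded_measurableZ.
- by apply: bounded_measurableD;
  [exact: bounded_measurableZ|exact: bounded_measurable_cst].
rewrite ExD//; last exact: bounded_measurableZ.
rewrite ExD; [|exact: bounded_measurableZ|exact: bounded_measurable_cst].
rewrite !(ExZ _ _ (bdev _)) Ex_cst.
have v1 := trunc_size_variance t t0.
have v2 := trunc_size_variance (t * L) t0.
have hN := Ex_large_batches t K0.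
have cLE : t%:R * c / (t * L)%N%:R = c / L%:R.
  by rewrite natrM; field; rewrite !pnatr_eq0; lia.
rewrite cLE in hN.
have w1 : 5 / (M * t%:R ^+ 2) * \int[P]_w dev t w <= 5 * (1 + 2 * c) / M.
  rewrite (_ : 5 * (1 + 2 * c) / M = 5 / (M * t%:R ^+ 2) * (t%:R ^+ 2 +
    2 * c * t%:R * t%:R)); last first.
    by field; rewrite !gt_eqF.
  by rewrite ler_wpM2l// divr_ge0// mulr_ge0 ?sqr_ge0// ltW.
have w2 : 1 / (2 * M * t%:R ^+ 2) * \int[P]_w dev (t * L)%N w <=
    (L%:R ^+ 2 + 2 * c * L%:R) / 2 / M.
  rewrite (_ : _ / 2 / M = 1 / (2 * M * t%:R ^+ 2) *
      ((t * L)%N%:R ^+ 2 + 2 * c * (t * L)%N%:R * t%:R)); last first.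
    by rewrite natrM; field; rewrite !gt_eqF.
  by rewrite ler_wpM2l// divr_ge0// !mulr_ge0 ?sqr_ge0// ltW.
apply: (le_trans (lerD (lerD w1 hN) (lerD w2 (lexx _)))).
rewrite (_ : _ + _ + _ = (5 * (1 + 2 * c) + (L%:R ^+ 2 + 2 * c * L%:R) / 2 +
  (3 / 2 + c * L%:R)) / M + c / L%:R); last by ring.
rewrite lerD2r ler_pM2r ?invr_gt0//.
have : 0 <= L%:R ^+ 2 :> R by rewrite sqr_ge0.
have : 0 <= c * L%:R by rewrite mulr_ge0.
by lra.
Qed.

(** A vertex of degree d is reached at rate about [d / (2 * t.+1)] times this
    factor. *)
Definition rate_factor (t : nat) (g : multigraph) : R :=
  t.+1%:R * m (size g) / (size g)%:R.

Lemma rate_factor_bound t g : 0 <= rate_factor t g <= t.+1%:R.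
Proof.
rewrite /rate_factor divr_ge0 ?mulr_ge0 ?trunc_mean_ge0//= -mulrA.
rewrite -[leRHS]mulr1 ler_wpM2l//; case: (size g) => [|n].
  by rewrite invr0 mulr0.
by rewrite ler_pdivrMr ?ltr0n// mul1r trunc_mean_le.
Qed.

Lemma bounded_measurable_rate_factor t :
  bounded_measurable (fun w => `|rate_factor t (G t w) - 1|).
Proof.
apply: (@bounded_measurable_graph t (fun g =>
  `|rate_factor t g - 1|) (t.+1%:R + 1)).
move=> g; have /andP[h0 h1] := rate_factor_bound t g.
by rewrite normr_id ler_norml; lra.
Qed.

(* The slow variation of m replaces m at the number of edges by m t. *)
Let rate_factor_mean t L : (0 < t)%N -> (0 < L)%N ->
  \int[P]_w `|rate_factor t (G t w) - 1| <=
  2 * (1 + c * L%:R / m t) * \int[P]_w `|t%:R * m t / (size (G t w))%:R - 1|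
  + (2 * (c * L%:R / m t + c / L%:R) + t%:R^-1).
Proof.
move=> t0 L0; have m1 : 1 <= m t by exact: trunc_mean_ge1.
have m0 : 0 < m t by lra.
have tR : 0 < t%:R :> R by rewrite ltr0n.
have LR : 0 < L%:R :> R by rewrite ltr0n.
have bL : bounded_measurable (fun w => `|t%:R * m t / (size (G t w))%:R - 1|).
  by apply: bounded_inverse_size; rewrite mulr_ge0// ltW.
set rho := c * L%:R / m t;
  have rho0 : 0 <= rho by rewrite divr_ge0 ?mulr_ge0// ltW.
have cL0 : 0 <= c / L%:R by rewrite divr_ge0.
rewrite -ExZ// -[X in _ <= _ + X](Ex_cst P) -ExD; last 2 first.
- exact: bounded_measurableZ.
- exact: bounded_measurable_cst.
apply: (Ex_le_ae _ (graph_ae_well_formed t0)).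
- exact: (discrete_preimage [set h | ~~ well_formed t h] (discrete_graph Xs C
  t)).
- exact: bounded_measurable_rate_factor.
- by apply: bounded_measurableD;
  [exact: bounded_measurableZ|exact: bounded_measurable_cst].
move=> w /negP; rewrite negbK => /andP[_ tsize]; rewrite /rate_factor.
have s0 : 0 < (size (G t w))%:R :> R by rewrite ltr0n (leq_trans t0).
have slow := trunc_mean_slow tail_le (size (G t w)) t0 L0.
have mono := trunc_mean_mono mu tsize.
rewrite -/m in slow mono; set Lam : R := (size (G t w))%:R in s0 slow *.
set mL := m (size _) in slow mono *.
pose x := t%:R * m t / Lam; rewrite -/x.
pose a := t%:R * mL / Lam.
have tL0 : 0 < t%:R / Lam by rewrite divr_gt0.
have ax : x <= a by rewrite ler_pM2r ?invr_gt0// ler_pM2l.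
have xa : a <= (1 + rho) * x + c / L%:R.
  have := ler_wpM2l (ltW tL0) slow.
  rewrite (_ : t%:R / Lam * mL = a); last by rewrite /a mulrAC.
  rewrite (_ : t%:R / Lam * _ = (1 + rho) * x + c / L%:R)//.
  by rewrite /x /rho; field; rewrite !gt_eqF.
have ha : `|a - 1| <= (1 + rho) * `|x - 1| + (rho + c / L%:R).
  have r0 : 0 <= rho * `|x - 1| by rewrite mulr_ge0.
  have [a1|a1] := leP 1 a.
    rewrite ger0_norm ?subr_ge0//.
    have : (1 + rho) * (x - 1) <= (1 + rho) * `|x - 1|.
      by rewrite ler_wpM2l ?ler_norm// addr_ge0.
    lra.
  rewrite ltr0_norm ?subr_lt0//.
  have : - (x - 1) <= `|x - 1| by rewrite -normrN ler_norm.
  lra.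
rewrite (_ : _ / Lam - 1 = (a - 1) * (1 + t%:R^-1) + t%:R^-1); last first.
  by rewrite /a -natr1; field; rewrite !gt_eqF.
have it : 0 <= t%:R^-1 :> R by [].
have it1 : t%:R^-1 <= 1 :> R by rewrite invf_le1// ler1n.
rewrite (le_trans (ler_normD _ _))// (ger0_norm it) addrA lerD2r.
rewrite normrM (ger0_norm (_ : 0 <= 1 + t%:R^-1)) ?addr_ge0//.
have : `|a - 1| * (1 + t%:R^-1) <= `|a - 1| * 2 by rewrite ler_wpM2l//; lra.
lra.
Qed.

Lemma rate_factor_lln : (forall B, exists M, B <= m M) ->
  forall e, 0 < e ->
  \forall t \near \oo, \int[P]_w `|rate_factor t (G t w) - 1| <= e.
Proof.
move=> m_unbounded e e0.
have [L L0 Le] : exists2 L : nat, (0 < L)%N & 4 * c / L%:R <= e / 2.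
  exists (Num.truncn (8 * c / e)).+1 => //.
  rewrite ler_pdivrMr ?ltr0n//.
  have := truncnS_gt (8 * c / e); rewrite ltr_pdivrMr//; lra.
(* K is the coefficient of 1 / m t in [inverse_size_lln], K' the one that
   [rate_factor_mean] produces from it, as 1 <= m t <= t. *)
pose K : R := 7 + 10 * c + (L%:R + 2 * c) * L%:R + c * L%:R.
pose K' := 2 * K + 2 * c * L%:R * K + 2 * c ^+ 2 + 2 * c * L%:R + 1.
have [M hM] := m_unbounded (K' * 2 / e).
near=> t.
have t0 : (0 < t)%N by near: t; exact: nbhs_infty_ge.
have Mt : (M <= t)%N by near: t; exact: nbhs_infty_ge.
have m1 : 1 <= m t by exact: trunc_mean_ge1.
have m0 : 0 < m t by lra.
have LR : 0 < L%:R :> R by rewrite ltr0n.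
have tR : 0 < t%:R :> R by rewrite ltr0n.
apply: (le_trans (rate_factor_mean t0 L0)).
have cL0 : 0 <= c * L%:R by rewrite mulr_ge0.
have c20 : 0 <= c ^+ 2 by rewrite sqr_ge0.
have hD := inverse_size_lln t0 L0; rewrite -/K in hD.
have K0 : 0 <= K by rewrite /K !addr_ge0 ?mulr_ge0 ?addr_ge0 ?mulr_ge0.
have i0 : 0 < (m t)^-1 by rewrite invr_gt0.
have i1 : (m t)^-1 <= 1 by rewrite invf_le1.
have it : t%:R^-1 <= (m t)^-1 by rewrite lef_pV2// trunc_mean_le.
have hK : K' * (m t)^-1 <= e / 2.
  have : K' * 2 / e <= m t := le_trans hM (trunc_mean_mono mu Mt).
  by rewrite !ler_pdivrMr//; lra.
have rho0 : 0 <= c * L%:R / m t by rewrite divr_ge0// ltW.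
apply: (@le_trans _ _ (2 * (1 + c * L%:R / m t) * (K / m t + c / L%:R) +
    (2 * (c * L%:R / m t + c / L%:R) + (m t)^-1))).
  rewrite lerD//; last by rewrite lerD2l.
  by rewrite ler_wpM2l// mulr_ge0// addr_ge0.
have cLL : c * L%:R / m t * (c / L%:R) = c ^+ 2 * (m t)^-1.
  by field; rewrite !gt_eqF.
have hcK : c * L%:R / m t * (K / m t) <= c * L%:R * K * (m t)^-1.
  rewrite (_ : c * L%:R / m t * (K / m t) = c * L%:R * K * (m t)^-1 * (m
    t)^-1); last by ring.
  by rewrite ler_piMr// mulr_ge0 ?mulr_ge0// ltW.
have -> : 2 * (1 + c * L%:R / m t) * (K / m t + c / L%:R) =
  2 * (K / m t) + 2 * (c / L%:R) + 2 * (c * L%:R / m t * (K / m t)) +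
  2 * (c * L%:R / m t * (c / L%:R)) by ring.
rewrite cLL.
have hK2 : K' * (m t)^-1 = 2 * (K / m t) + 2 * (c * L%:R * K * (m t)^-1) +
   2 * (c ^+ 2 * (m t)^-1) + 2 * (c * L%:R / m t) + (m t)^-1 by rewrite /K';
     ring.
have : 4 * c / L%:R = 4 * (c / L%:R) by rewrite mulrA.
lra.
Unshelve. all: by end_near.
Qed.

End TailBound.
End EdgeGrowth.

(** * Drift of the squared deviation and summation of the increments *)

(** The mean of [batch_ratio] is the average of the first L tails, and the tail
    bound makes the mean of its square O(1 / L). *)
Lemma Ex_batch_polynomial (R : realType) (mu : probability nat R) (c : R)
    (tail_le : forall j, tail mu j.+1 <= c / j.+1%:R) (L k : nat)
    (A0 A1 A2 A3 : R) : (0 < L)%N -> 0 <= A3 ->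
  \int[mu]_n (A0 + A1 * (n == k)%:R + A2 * batch_ratio L n
              + A3 * batch_ratio L n ^+ 2)
  <= A0 + A1 * fine (mu [set k]) + A2 * (trunc_mean mu L / L%:R)
     + A3 * (2 * c / L%:R).
Proof.
move=> L0 A30; have LR : 0 < L%:R :> R by rewrite ltr0n.
have bp : bounded_measurable (fun n => (n == k)%:R : R) by exact: bool_bounded.
have bm : bounded_measurable (fun n => (minn n L)%:R : R).
  apply: (@bounded_measurable_nat _ _ L%:R) => n.
  by rewrite ger0_norm// ler_nat geq_minr.
have bu : bounded_measurable (batch_ratio L : nat -> R).
  by apply: bounded_measurableM => //; exact: bounded_measurable_cst.
have bu2 : bounded_measurable (fun n => batch_ratio L n ^+ 2 : R).
  exact: (bounded_measurableM bu bu).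
have b0 := @bounded_measurable_cst _ nat R A0.
have b1 := bounded_measurableZ A1 bp.
have b2 := bounded_measurableZ A2 bu.
have b3 := bounded_measurableZ A3 bu2.
rewrite (ExD mu (bounded_measurableD (bounded_measurableD b0 b1) b2) b3).
rewrite (ExD mu (bounded_measurableD b0 b1) b2) (ExD mu b0 b1) Ex_cst.
rewrite (ExZ mu A1 bp) (ExZ mu A2 bu) (ExZ mu A3 bu2) Ex_point.
have -> : \int[mu]_n batch_ratio L n = trunc_mean mu L / L%:R.
  under eq_Rintegral do rewrite /batch_ratio mulrC.
  by rewrite (ExZ mu _ bm) Ex_minn mulrC.
rewrite lerD2l ler_wpM2l//.
have bm2 : bounded_measurable (fun n => (minn n L)%:R ^+ 2 : R).
  exact: (bounded_measurableM bm bm).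
have -> : \int[mu]_n batch_ratio L n ^+ 2 =
    L%:R ^- 2 * \int[mu]_n (minn n L)%:R ^+ 2.
  rewrite -(ExZ mu _ bm2); apply: eq_Rintegral => n _.
  by rewrite /batch_ratio exprMn exprVn mulrC.
rewrite (_ : 2 * c / L%:R = L%:R ^- 2 * (2 * c * L%:R)); last first.
  by field; rewrite gt_eqF.
rewrite ler_wpM2l ?invr_ge0 ?sqr_ge0//.
exact: Ex_minn_sqr.
Qed.

(** Drift of the squared deviation.  Here s is the number of vertices, L the
    number of edges, r and r' the proportions of degrees k and k' = k - 1, and
    kap the rate factor.  The recurrence for b cancels the constant terms of the
    mean increment; the quadratic form x (k' y - k x) that remains is at most
    k' y^2, whatever x is. *)
Lemma drift_inequality (R : realType)
    (k k' s r r' b b' x y p kap mL m L c C1 : R) :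
  k = k' + 1 -> 0 <= k' -> 1 <= s -> 0 <= r <= 1 -> 0 <= r' <= 1 ->
  0 <= b -> (k + 2) * b = 2 * p + k' * b' ->
  0 < L -> 1 <= m -> m <= mL -> kap = s * mL / L -> 0 <= c -> 0 <= C1 ->
  x = r - b -> y = r' - b' ->
  (s * x) ^+ 2 - 2 * (s * x) * b + C1 + 2 * (s * x) * p
  + (s * x * (k' * (s * r') - k * (s * r)) + C1 * s) * (mL / L)
  + C1 * s ^+ 2 * (2 * c / L) <=
  (s * x) ^+ 2 + s * ((1 + (1 + b) * k + 2 * C1 + 2 * c * C1) *
    (k' * y ^+ 2 + `|kap - 1| + m^-1 + s^-1)).
Proof.
move=> kE k'0 s1 /andP[r0 r1] /andP[r'0 r'1] b0 rec L0 m1 mmL kapE c0 C10 xE yE.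
have s0 : 0 < s by lra.
have m0 : 0 < m by lra.
have kap0 : 0 <= kap by rewrite kapE divr_ge0 ?mulr_ge0//; lra.
set A := `|kap - 1|.
have A0 : 0 <= A by rewrite /A.
have kapA : kap <= 1 + A by have := ler_norm (kap - 1); rewrite -/A; lra.
have mLE : mL / L = kap / s by rewrite kapE; field; rewrite !gt_eqF.
have sL : s / L <= m^-1 + A.
  have -> : s / L = kap / mL by rewrite kapE; field; rewrite !gt_eqF//; lra.
  rewrite (@le_trans _ _ (kap / m))// ?ler_wpM2l// ?lef_pV2 ?posrE//;
    first by lra.
  have : kap / m <= (1 + A) / m by rewrite ler_wpM2r// invr_ge0 ltW.
  have : A / m <= A by rewrite ler_pdivrMr// ler_peMr.
  by rewrite [(1 + A) / m]mulrDl mul1r; lra.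
have i0 : 0 < m^-1 by rewrite invr_gt0.
have is0 : 0 < s^-1 by rewrite invr_gt0.
have ss : s * s^-1 = 1 by rewrite divff// gt_eqF.
have k0 : 0 <= k by lra.
have ky0 : 0 <= k' * y ^+ 2 by rewrite mulr_ge0// sqr_ge0.
pose D := k' * r' - k * r.
have hD : `|D| <= k.
  have : 0 <= k' * r' <= k' by rewrite mulr_ge0// ler_piMr.
  have : 0 <= k * r <= k by rewrite mulr_ge0// ler_piMr.
  by move=> /andP[? ?] /andP[? ?]; rewrite /D ler_norml; lra.
have hx : `|x| <= 1 + b by rewrite xE ler_norml; lra.
have hxD : x * (k' * y - k * x) <= k' * y ^+ 2.
  have : 0 <= k' * (x - y) ^+ 2 by rewrite mulr_ge0// sqr_ge0.
  have : 0 <= (k' + 2) * x ^+ 2 by rewrite mulr_ge0 ?sqr_ge0//; lra.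
  by rewrite kE; nra.
have hxDA : x * (D * (kap - 1)) <= (1 + b) * k * A.
  rewrite (le_trans (ler_norm _))// !normrM -/A mulrA ler_wpM2r// ler_pM//.
have lin : - (2 * (s * x) * b) + 2 * (s * x) * p +
    s * x * (k' * (s * r') - k * (s * r)) * (mL / L) =
    s * (x * (k' * y - k * x) + x * (D * (kap - 1))).
  have -> : 2 * (s * x) * p = s * x * ((k + 2) * b - k' * b') by rewrite rec;
    ring.
  rewrite mLE (_ : _ * (kap / s) = s * x * D * kap * (s * s^-1));
    last by rewrite /D; ring.
  by rewrite ss /D xE yE; ring.
have h1 : s * (x * (k' * y - k * x) + x * (D * (kap - 1))) <=
    s * (k' * y ^+ 2 + (1 + b) * k * A).
  by rewrite ler_wpM2l ?(ltW s0)// lerD.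
have h2 : C1 * s * (mL / L) <= C1 * (1 + A).
  rewrite mLE (_ : C1 * s * (kap / s) = C1 * kap * (s * s^-1)); last by ring.
  by rewrite ss mulr1 ler_wpM2l.
have h3 : C1 * s ^+ 2 * (2 * c / L) <= s * (2 * c * C1 * (m^-1 + A)).
  rewrite (_ : C1 * s ^+ 2 * (2 * c / L) = s * (2 * c * C1 * (s / L)));
    last by ring.
  by rewrite ler_wpM2l ?(ltW s0)// ler_wpM2l// !mulr_ge0.
have h4 : C1 * A <= s * (C1 * A) by rewrite ler_peMl ?mulr_ge0.
pose C2 := 1 + (1 + b) * k + 2 * C1 + 2 * c * C1.
have cC0 : 0 <= 2 * c * C1 by rewrite !mulr_ge0.
have bk0 : 0 <= (1 + b) * k by rewrite mulr_ge0// addr_ge0.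
have E : s * (C2 * (k' * y ^+ 2 + A + m^-1 + s^-1)) =
    s * (C2 * (k' * y ^+ 2)) + s * (C2 * A) + s * (C2 * m^-1) + C2 * (s * s^-1).
  by ring.
rewrite -/C2 E ss.
have g1 : s * (k' * y ^+ 2) <= s * (C2 * (k' * y ^+ 2)).
  by rewrite ler_wpM2l ?(ltW s0)// ler_peMl// /C2; lra.
have g2 : s * ((1 + b) * k * A + C1 * A + 2 * c * C1 * A) <= s * (C2 * A).
  by rewrite ler_wpM2l ?(ltW s0)// -!mulrDl ler_wpM2r// /C2; lra.
have g3 : s * (2 * c * C1 * m^-1) <= s * (C2 * m^-1).
  by rewrite ler_wpM2l ?(ltW s0)// ler_wpM2r ?(ltW i0)// /C2; lra.
have g4 : 2 * C1 <= C2 * 1 by rewrite /C2; lra.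
lra.
Qed.

(** The sum of the increments [t.+1 * eps t] up to time t is at most o(t^2). *)
Lemma cesaro_bound (R : realType) (v eps : nat -> R) :
  (forall t, (0 < t)%N -> v t.+1 <= v t + t.+1%:R * eps t) ->
  (forall e : R, 0 < e -> \forall t \near \oo, eps t <= e) ->
  forall e : R, 0 < e -> \forall t \near \oo, v t / t.+1%:R ^+ 2 <= e.
Proof.
move=> hv heps e e0.
have e20 : 0 < e / 2 by rewrite divr_gt0.
have [t0 _ h0] := heps (e / 2) e20.
pose t1 := maxn t0 1.
have bound t : (t1 <= t)%N -> v t <= `|v t1| + e / 2 * t.+1%:R ^+ 2.
  move=> /subnKC <-; elim: (t - t1)%N => [|i IH].
    rewrite addn0 (le_trans (ler_norm _))// lerDl mulr_ge0 ?sqr_ge0//; lra.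
  have t10 : (0 < t1 + i)%N by rewrite /t1; lia.
  rewrite addnS (le_trans (hv _ t10))//.
  have he : eps (t1 + i)%N <= e / 2 by apply: h0; rewrite /= /t1; lia.
  have : (t1 + i).+1%:R * eps (t1 + i)%N <= (t1 + i).+1%:R * (e / 2).
    by rewrite ler_wpM2l.
  have x0 : 0 <= (t1 + i).+1%:R :> R by [].
  move: IH; rewrite -[(t1 + i).+2%:R]natr1; set x := (t1 + i).+1%:R in x0 *.
  nra.
have [K hK] : exists K : nat, `|v t1| <= e / 2 * K%:R.
  exists (Num.truncn (`|v t1| * 2 / e)).+1.
  have := truncnS_gt (`|v t1| * 2 / e); rewrite ltr_pdivrMr//; lra.
near=> t.
have t1t : (t1 <= t)%N by near: t; exact: nbhs_infty_ge.
have Kt : (K <= t)%N by near: t; exact: nbhs_infty_ge.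
have x0 : 0 < t.+1%:R :> R by rewrite ltr0n.
rewrite ler_pdivrMr ?exprn_gt0//.
have hb := bound _ t1t.
have : `|v t1| <= e / 2 * t.+1%:R.
  by rewrite (le_trans hK)// ler_wpM2l ?ler_nat ?leqW// ltW// divr_gt0.
have : 1 <= t.+1%:R :> R by rewrite ler1n.
move: hb; set x := t.+1%:R in x0 *; nra.
Unshelve. all: by end_near.
Qed.

(** * Mean-square convergence of the degree proportions *)

Section DegreeCounts.
Context {R : realType}.

Definition degree_count (t : nat) (g : multigraph) (k : nat) : R :=
  count_degree (fun v : 'I_t.+1 => degree g v) k.

Lemma degree_count_invariant t k : perm_invariant (fun g => degree_count t g k).
Proof.
by move=> g h gh; apply: eq_bigr => v _; rewrite (degree_invariant _ gh).
Qed.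

Lemma degree_count_bound t g k : 0 <= degree_count t g k <= t.+1%:R.
Proof.
by have := count_degree_bound (R := R) (fun v : 'I_t.+1 =>
  degree g v) k; rewrite card_ord.
Qed.

Lemma degree_count_attach_batch t n g (s : {ffun 'I_n -> 'I_t.+1}) k :
  well_formed t g -> degree_count t.+1 (attach_batch g s) k =
  degree_count t g k + degree_gain (fun v : 'I_t.+1 =>
    degree g v) k s + (n == k)%:R.
Proof.
move=> wf; rewrite /degree_count /count_degree big_ord_recr /=.
rewrite degree_attach_batch_new//; congr (_ + _).
rewrite /degree_gain -big_split /=; apply: eq_bigr => v _.
by rewrite degree_attach_batch//; ring.
Qed.

End DegreeCounts.

Section Deviation.
Context {d} {T : measurableType d} {R : realType} (P : probability T R).
Context (mu : probability nat R).
Context (Xs : nat -> {RV P >-> nat}) (C : nat -> nat -> {RV P >-> nat}).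
Hypothesis model : parid mu Xs C.

Let G (t : nat) (w : T) : multigraph := parid_graph Xs C t w.
Let mu0 : mu [set 0%N] = 0%E := parid_pos model.

Lemma prop_degreeE k t w :
  prop_degree Xs C k t w = degree_count t (G t w) k / t.+1%:R.
Proof.
rewrite /prop_degree /num_degree /degree_count /count_degree; congr (_ / _).
rewrite -sum1_count natr_sum big_mkcond -[iota _ _]/(index_iota 0 t.+1)
  big_mkord.
by apply: eq_bigr => v _; case: eqP.
Qed.

Variable c : R.
Hypothesis tail_le : forall j, tail mu j.+1 <= c / j.+1%:R.
Hypothesis mean_infinite : forall B, exists M, B <= trunc_mean mu M.
Variable b : nat -> R.
Hypothesis b_ge0 : forall k, 0 <= b k.
Hypothesis b_rec : forall k, (k.+1%:R + 2) * b k.+1 =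
  2 * fine (mu [set k.+1]) + k%:R * b k.

Let c0 : 0 <= c := tail_cst_ge0 tail_le.
Let m := trunc_mean mu.

Definition deviation (k t : nat) (g : multigraph) : R :=
  degree_count t g k / t.+1%:R - b k.

Let ratio_bound k t g : 0 <= (degree_count t g k / t.+1%:R : R) <= 1.
Proof.
have /andP[h0 h1] := degree_count_bound (R := R) t g k.
by rewrite divr_ge0//= ler_pdivrMr ?ltr0n// mul1r.
Qed.

Let deviation_bound k t g : `|deviation k t g| <= 1 + b k.
Proof.
have /andP[] := ratio_bound k t g; have := b_ge0 k; rewrite /deviation.
by move: (_ / _) => r ? ? ?; rewrite ler_norml; lra.
Qed.

Let deviation_invariant k t : perm_invariant (deviation k t).
Proof.
by move=> g h gh; rewrite /deviation (degree_count_invariant _ _ gh).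
Qed.

Let scaled k t g :
  t.+1%:R * deviation k t g = degree_count t g k - b k * t.+1%:R.
Proof.
by rewrite /deviation mulrBr mulrCA divff ?mulr1 ?pnatr_eq0//
  mulrC [b k * _]mulrC.
Qed.

Let C1 k : R :=
  2 * (1 + b k) * k.+1%:R ^+ 2 + 2 * k.+1%:R ^+ 2 + 2 * (1 + b k) ^+ 2.

Let C1_ge0 k : 0 <= C1 k.
Proof.
have b0 := b_ge0 k.
by rewrite /C1 !addr_ge0// ?mulr_ge0 ?sqr_ge0 ?addr_ge0.
Qed.

(* The bound for the squared deviation after a step with n edges, arranged as a
   polynomial in [batch_ratio] and the indicator of [n = k], whose means are
   known; C1 collects the second-order terms. *)
Let step_value k t g n : R :=
  let s := t.+1%:R in
  (s * deviation k t g) ^+ 2 - 2 * (s * deviation k t g) * b k + C1 k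
  + 2 * (s * deviation k t g) * (n == k)%:R
  + (s * deviation k t g * (k.-1%:R * degree_count t g k.-1
                            - k%:R * degree_count t g k) + C1 k * s)
    * batch_ratio (size g) n
  + C1 k * s ^+ 2 * batch_ratio (size g) n ^+ 2.

(** Expanding the square around the old deviation, only the mean and the second
    moment of [degree_gain] enter. *)
Lemma deviation_step k t g n : (0 < k)%N -> (0 < t)%N -> well_formed t g ->
  sampleE (fun v : 'I_t.+1 => attach_prob R g v)
    (fun s : {ffun 'I_n -> 'I_t.+1} =>
       (t.+2%:R * deviation k t.+1 (attach_batch g s)) ^+ 2)
  <= step_value k t g n.
Proof.
move=> k0 t0 wf.
have g0 : (0 < size g)%N by case/andP: wf => _; exact: leq_trans.
have degL := sum_degree wf.
pose deg (v : 'I_t.+1) := degree g v.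
pose a := degree_weight (R := R) deg (size g).
have a0 : forall v, 0 <= a v by exact: degree_weight_ge0.
have a1 : \sum_v a v = 1 by exact: sum_degree_weight.
pose W := t.+1%:R * deviation k t g.
pose e : R := (n == k)%:R - b k.
have bk := b_ge0 k.
have e1 : e ^+ 2 <= (1 + b k) ^+ 2.
  rewrite -[leLHS]ger0_norm ?sqr_ge0// normr_sqr_le//.
  by rewrite /e; case: (_ == _); rewrite ler_norml /=; lra.
apply: (@le_trans _ _ (sampleE a (fun s : {ffun 'I_n -> 'I_t.+1} =>
    (W ^+ 2 + 2 * W * e + 2 * (1 + b k) ^+ 2) +
    (2 * W * degree_gain deg k s + 2 * degree_gain deg k s ^+ 2)))).
  apply: sampleE_le => // s.
  have -> : t.+2%:R * deviation k t.+1 (attach_batch g s) =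
      W + degree_gain deg k s + e.
    rewrite scaled degree_count_attach_batch// /W scaled /e -[t.+2%:R]natr1.
    by ring.
  have : 0 <= (degree_gain deg k s - e) ^+ 2 by rewrite sqr_ge0.
  nra.
rewrite sampleED (sampleE_cst a1) sampleED !sampleEZ.
have := degree_gain_mean (R := R) g0 degL k0 n.
have := degree_gain_second_moment (R := R) g0 degL k0 n.
rewrite card_ord -/deg -/a.
have u0 := batch_ratio_ge0 (R := R) (size g) n.
rewrite /step_value /degree_count -/deg -/W.
set u := batch_ratio _ _ in u0 *; set D := _ - _ * count_degree _ _.
set E2 := sampleE _ _; set E1 := sampleE _ _ => hE2 hE1.
have hW : `|W| <= t.+1%:R * (1 + b k).
  by rewrite /W normrM ger0_norm// ler_wpM2l.
have hWE : 2 * W * E1 <= W * D * u +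
    2 * (1 + b k) * k.+1%:R ^+ 2 * t.+1%:R ^+ 2 * u ^+ 2.
  have : W * (E1 - u * (D / 2)) <=
      t.+1%:R * (1 + b k) * (k.+1%:R ^+ 2 * t.+1%:R * u ^+ 2).
    by rewrite (le_trans (ler_norm _))// normrM ler_pM.
  lra.
have s0 : 0 <= t.+1%:R * u :> R by rewrite mulr_ge0.
have s1 : 0 <= t.+1%:R ^+ 2 * u ^+ 2 :> R by rewrite mulr_ge0 ?sqr_ge0.
have hB : 0 <= 2 * (1 + b k) * k.+1%:R ^+ 2
  by rewrite !mulr_ge0 ?addr_ge0 ?sqr_ge0.
have hK : 0 <= 2 * k.+1%:R ^+ 2 :> R by rewrite mulr_ge0 ?sqr_ge0.
have hS : 0 <= 2 * (1 + b k) ^+ 2 by rewrite mulr_ge0 ?sqr_ge0.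
have j1 :
    (2 * (1 + b k) * k.+1%:R ^+ 2 + 2 * k.+1%:R ^+ 2)
      * (t.+1%:R ^+ 2 * u ^+ 2) <= C1 k * (t.+1%:R ^+ 2 * u ^+ 2).
  by rewrite ler_wpM2r// /C1; lra.
have j2 : 2 * k.+1%:R ^+ 2 * (t.+1%:R * u) <= C1 k * (t.+1%:R * u).
  by rewrite ler_wpM2r// /C1; lra.
have j3 : 2 * (1 + b k) ^+ 2 <= C1 k by rewrite /C1; lra.
rewrite /e; lra.
Qed.

Let C2 k : R := 1 + (1 + b k) * k%:R + 2 * C1 k + 2 * c * C1 k.

Let C2_ge0 k : 0 <= C2 k.
Proof.
have h0 := C1_ge0 k; have h1 : 0 <= c * C1 k by rewrite mulr_ge0.
have h2 : 0 <= (1 + b k) * k%:R by rewrite mulr_ge0// addr_ge0.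
rewrite /C2; lra.
Qed.

Let next_bound k t g : R := (t.+1%:R * deviation k t g) ^+ 2 +
  t.+1%:R * (C2 k * (k.-1%:R * deviation k.-1 t g ^+ 2
    + `|rate_factor mu t g - 1| + (m t)^-1 + t.+1%:R^-1)).

(** Average [deviation_step] over the draws, then over the size of the batch. *)
Lemma deviation_next k t : (0 < k)%N -> (0 < t)%N ->
  \int[P]_w ((t.+2%:R * deviation k t.+1 (G t.+1 w)) ^+ 2) <=
  \int[P]_w next_bound k t (G t w).
Proof.
move=> k0 t0.
have wf := graph_ae_well_formed model t0.
have bk := b_ge0 k.
have m1 : 1 <= m t by exact: trunc_mean_ge1.
have Wb t' g : `|t'.+1%:R * deviation k t' g| <= t'.+1%:R * (1 + b k).
  by rewrite normrM ger0_norm// ler_wpM2l.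
pose s : R := t.+1%:R.
have s0 : 0 <= s by rewrite /s.
(* Bq and BH are crude uniform bounds, which only serve integrability. *)
pose Bq := (s * (1 + b k)) ^+ 2 + 2 * (s * (1 + b k)) * b k + C1 k +
  2 * (s * (1 + b k)) + (s * (1 + b k) * (k%:R * s) + C1 k * s) + C1 k * s ^+ 2.
pose BH := (s * (1 + b k)) ^+ 2 + s * (C2 k * (k.-1%:R * (1 + b k.-1) ^+ 2
  + (s + 1) + (m t)^-1 + s^-1)).
have C10 := C1_ge0 k.
have sB0 : 0 <= s * (1 + b k) by rewrite mulr_ge0// addr_ge0.
have C20 := C2_ge0 k.
have i0 : 0 <= (m t)^-1 by rewrite invr_ge0; lra.
have bounds g n : `|step_value k t g n| <= Bq.
  have u0 := batch_ratio_ge0 (R := R) (size g) n.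
  have u1 : batch_ratio (size g) n <= 1 :> R.
    rewrite /batch_ratio; case: (size g) => [|l]; first by rewrite invr0 mulr0.
    by rewrite ler_pdivrMr ?ltr0n// mul1r ler_nat geq_minr.
  rewrite /step_value; set u := batch_ratio _ _ in u0 u1 *.
  have u2 : `|u ^+ 2| <= 1 by rewrite -[leRHS](expr1n _ 2) normr_sqr_le//
    ger0_norm.
  have un : `|u| <= 1 by rewrite ger0_norm.
  rewrite (le_trans (ler_normD _ _))// lerD//; last first.
    rewrite normrM -[leRHS]mulr1 ler_pM// ger0_norm// mulr_ge0// sqr_ge0.
  rewrite (le_trans (ler_normD _ _))// lerD//; last first.
    rewrite normrM -[leRHS]mulr1 ler_pM//.
    rewrite (le_trans (ler_normD _ _))// lerD//;
      last by rewrite ger0_norm// mulr_ge0.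
    rewrite normrM ler_pM//.
    have /andP[h0 h1] := degree_count_bound (R := R) t g k.
    have /andP[h2 h3] := degree_count_bound (R := R) t g k.-1.
    have h4 : 0 <= (k%:R * degree_count t g k : R) <= k%:R * s.
      by rewrite mulr_ge0//= ler_wpM2l.
    have h5 : 0 <= (k.-1%:R * degree_count t g k.-1 : R) <= k%:R * s.
      by rewrite mulr_ge0//= ler_pM// ler_nat leq_pred.
    move: h4 h5 => /andP[? ?] /andP[? ?]; rewrite ler_norml; lra.
  rewrite (le_trans (ler_normD _ _))// lerD//; last first.
    rewrite normrM -[leRHS]mulr1 ler_pM//; last by case: (_ == _);
      rewrite ?normr0 ?normr1.
    by rewrite normrM ger0_norm// ler_wpM2l.
  rewrite (le_trans (ler_normD _ _))// lerD//; last by rewrite ger0_norm.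
  rewrite (le_trans (ler_normB _ _))// lerD//; first by rewrite normr_sqr_le.
  by rewrite normrM (ger0_norm bk) ler_wpM2r// normrM ger0_norm// ler_wpM2l.
have boundsH g : `|next_bound k t g| <= BH.
  have /andP[r0 r1] := rate_factor_bound mu t g.
  have r2 : `|rate_factor mu t g - 1| <= s + 1
    by rewrite ler_norml -/s in r1 *; lra.
  rewrite /next_bound (le_trans (ler_normD _ _))// lerD//;
    first by rewrite normr_sqr_le.
  rewrite normrM ger0_norm// ler_wpM2l// normrM ger0_norm// ler_wpM2l//.
  rewrite (le_trans (ler_normD _ _))// lerD//; last by rewrite ger0_norm.
  rewrite (le_trans (ler_normD _ _))// lerD//; last by rewrite ger0_norm.
  rewrite (le_trans (ler_normD _ _))// lerD ?normr_id//.
  by rewrite normrM ger0_norm// ler_wpM2l// normr_sqr_le.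
have Bq0 : 0 <= Bq := le_trans (normr_ge0 _) (bounds [::] 0%N).
have BH0 : 0 <= BH := le_trans (normr_ge0 _) (boundsH [::]).
pose B := (t.+2%:R * (1 + b k)) ^+ 2 + (Bq + BH).
have B0 : 0 <= (t.+2%:R * (1 + b k)) ^+ 2 by rewrite sqr_ge0.
apply: (@le_trans _ _ (\int[P]_w step_value k t (G t w) (Xs t.+1 w))).
  apply: (@average_attachment _ _ _ P mu Xs C model t
    (fun g => (t.+2%:R * deviation k t.+1 g) ^+ 2) (step_value k t) B) => //.
  - by move=> g h gh; rewrite (deviation_invariant _ _ gh).
  - move=> n g h gh; rewrite /step_value (deviation_invariant _ _ gh).
    by rewrite !(degree_count_invariant _ _ gh) (size_invariant gh).
  - move=> g; rewrite (@le_trans _ _ ((t.+2%:R * (1 + b k)) ^+ 2))//.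
      by rewrite normr_sqr_le.
    by rewrite /B lerDl addr_ge0.
  - by move=> g n; rewrite (le_trans (bounds g n))// /B; lra.
  - by move=> g n; exact: deviation_step.
apply: (@average_batch _ _ _ P mu Xs C model t (step_value k t) (next_bound k
  t) B) => //.
- move=> n g h gh; rewrite /step_value (deviation_invariant _ _ gh).
  by rewrite !(degree_count_invariant _ _ gh) (size_invariant gh).
- move=> g h gh; rewrite /next_bound !(deviation_invariant _ _ gh).
  by rewrite /rate_factor (size_invariant gh).
- by move=> g n; rewrite (le_trans (bounds g n))// /B; lra.
- by move=> g; rewrite (le_trans (boundsH g))// /B; lra.
move=> g wg; rewrite /step_value.
have tg : (t <= size g)%N by case/andP: wg.
have g0 : (0 < size g)%N by exact: leq_trans tg.
apply: (le_trans (Ex_batch_polynomial tail_le _ _ _ _ g0 _)).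
  by rewrite mulr_ge0 ?sqr_ge0.
have sdc j : degree_count t g j = t.+1%:R * (degree_count t g j / t.+1%:R) :> R.
  by rewrite mulrCA divff ?mulr1// pnatr_eq0.
rewrite (sdc k) (sdc k.-1) /next_bound.
apply: (drift_inequality (b := b k) (b' := b k.-1)
    (r := degree_count t g k / t.+1%:R)
    (r' := degree_count t g k.-1 / t.+1%:R) (mL := m (size g))) => //.
- by rewrite natr1 prednK.
- by rewrite ler1n.
- by case: k k0 {bk Wb Bq BH C10 sB0 Bq0 C20 BH0 bounds boundsH B B0 sdc} =>
  // k _; exact: b_rec.
- by rewrite ltr0n.
- exact: trunc_mean_mono.
Qed.

(** By induction on the degree, since the increments of the squared deviation
    for k are controlled by the deviation for k - 1. *)
Lemma deviation_cvg k : (0 < k)%N -> forall e : R, 0 < e ->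
  \forall t \near \oo, \int[P]_w (deviation k t (G t w) ^+ 2) <= e.
Proof.
have bdev j t : bounded_measurable (fun w => deviation j t (G t w) ^+ 2).
  apply: (@bounded_measurable_graph _ _ _ P Xs C t (fun g =>
    deviation j t g ^+ 2) ((1 + b j) ^+ 2)).
  by move=> g; exact: normr_sqr_le.
have brf t := bounded_measurable_rate_factor mu Xs C t.
elim: k => // k IH _ e e0.
pose eps t : R := C2 k.+1 * (k%:R * \int[P]_w (deviation k t (G t w) ^+ 2)
  + \int[P]_w `|rate_factor mu t (G t w) - 1| + (m t)^-1 + t.+1%:R^-1).
pose v t := \int[P]_w ((t.+1%:R * deviation k.+1 t (G t w)) ^+ 2).
have vE t : v t = t.+1%:R ^+ 2 * \int[P]_w (deviation k.+1 t (G t w) ^+ 2).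
  rewrite -(ExZ P _ (bdev k.+1 t)); apply: eq_Rintegral => w _.
  by rewrite exprMn.
have step t : (0 < t)%N -> v t.+1 <= v t + t.+1%:R * eps t.
  move=> t0; apply: (le_trans (deviation_next (ltn0Sn k) t0)).
  rewrite /next_bound /= le_eqVlt; apply/orP; left; apply/eqP.
  have bc (x : R) : bounded_measurable (fun _ : T =>
    x) := bounded_measurable_cst x.
  have b1 := bounded_measurableZ k%:R (bdev k t).
  have b2 := bounded_measurableD b1 (brf t).
  have b3 := bounded_measurableD b2 (bc (m t)^-1).
  have b4 := bounded_measurableD b3 (bc t.+1%:R^-1).
  have b5 := bounded_measurableZ (C2 k.+1) b4.
  have b6 := bounded_measurableZ t.+1%:R b5.
  have b7 : bounded_measurable (fun w =>
    (t.+1%:R * deviation k.+1 t (G t w)) ^+ 2).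
    have := bounded_measurableZ (t.+1%:R ^+ 2) (bdev k.+1 t).
    by congr bounded_measurable; apply/funext => w; rewrite exprMn.
  rewrite (ExD P b7 b6) (ExZ P _ b5) (ExZ P _ b4) (ExD P b3 (bc _)).
  by rewrite (ExD P b2 (bc _)) (ExD P b1 (brf t)) (ExZ P _ (bdev k t)) !Ex_cst.
have C20 := C2_ge0 k.+1.
have heps : forall e : R, 0 < e -> \forall t \near \oo, eps t <= e.
  move=> {}e {}e0.
  (* One share for each of the four terms of eps. *)
  pose e' := e / (C2 k.+1 + 1) / 4.
  have e'0 : 0 < e' by rewrite !divr_gt0// ltr_wpDl.
  have h1 : \forall t \near \oo,
    k%:R * \int[P]_w (deviation k t (G t w) ^+ 2) <= e'.
    have [k00|kp] := posnP k.
      by apply: nearW => t; rewrite {1}k00 mul0r ltW.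
    have kR : 0 < k%:R :> R by rewrite ltr0n.
    have := IH kp (e' / k%:R) (divr_gt0 e'0 kR); apply: filterS => t.
    by rewrite ler_pdivlMr// mulrC.
  have h2 := rate_factor_lln model tail_le mean_infinite e'0.
  have [M hM] := mean_infinite (e'^-1).
  near=> t.
  have t0 : (0 < t)%N by near: t; exact: nbhs_infty_ge.
  have Mt : (M <= t)%N by near: t; exact: nbhs_infty_ge.
  have h1t : k%:R * \int[P]_w (deviation k t (G t w) ^+ 2) <= e' by near: t.
  have h2t : \int[P]_w `|rate_factor mu t (G t w) - 1| <= e' by near: t.
  have mt : e'^-1 <= m t := le_trans hM (trunc_mean_mono mu Mt).
  have i0 : 0 < e'^-1 by rewrite invr_gt0.
  have m0 : 0 < m t by lra.
  have h3 : (m t)^-1 <= e' by rewrite -[e']invrK lef_pV2.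
  have h4 : t.+1%:R^-1 <= e'.
    rewrite (le_trans _ h3)// lef_pV2 ?posrE ?ltr0n//.
    by rewrite (le_trans (trunc_mean_le _ _))// ler_nat.
  have C2p : 0 < C2 k.+1 + 1 by lra.
  rewrite /eps (@le_trans _ _ (C2 k.+1 * (4 * e')))//.
    rewrite ler_wpM2l// (le_trans (lerD (lerD (lerD h1t h2t) h3) h4))//.
    by move: (e') => x; lra.
  rewrite (_ : 4 * e' = e / (C2 k.+1 + 1)); last by rewrite /e'; field;
    rewrite gt_eqF.
  by rewrite mulrCA ler_piMr// ?(ltW e0)// ler_pdivrMr//; lra.
near=> t.
have x0 : 0 < t.+1%:R ^+ 2 :> R by rewrite exprn_gt0.
have : v t / t.+1%:R ^+ 2 <= e by near: t; exact: cesaro_bound step heps e e0.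
by rewrite vE mulrC mulrA mulVf ?mul1r// gt_eqF.
Unshelve. all: by end_near.
Qed.

Lemma prop_degree_cvg k : (0 < k)%N ->
  cvg_in_probability P (prop_degree Xs C k) (b k).
Proof.
move=> k0 e e0.
pose A t := [set w | e < `|prop_degree Xs C k t w - b k|].
have bdev t : bounded_measurable (fun w => deviation k t (G t w) ^+ 2).
  apply: (@bounded_measurable_graph _ _ _ P Xs C t (fun g =>
    deviation k t g ^+ 2) ((1 + b k) ^+ 2)).
  by move=> g; exact: normr_sqr_le.
have AE t : A t = [set w | e ^+ 2 < deviation k t (G t w) ^+ 2].
  apply/funext => w; apply/propext;
    rewrite /A /= prop_degreeE -/(deviation k t _).
  rewrite -[X in _ <-> is_true (_ < X)]real_normK ?num_real//.
  by rewrite ltr_pXn2r// ?nnegrE// ltW.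
have mA t : measurable (A t).
  rewrite AE.
  exact: (discrete_preimage [set g | e ^+ 2 < deviation k t g ^+ 2]
            (discrete_graph Xs C t)).
apply/fine_cvgP; split.
  by apply: nearW => t; apply: fin_num_measure; exact: (mA t).
apply/cvgrPdist_le => /= e' e'0; near=> t.
rewrite sub0r normrN ger0_norm ?fine_ge0// -/(A t) AE.
apply: (@le_trans _ _ (\int[P]_w (deviation k t (G t w) ^+ 2) / e ^+ 2)).
  by apply: Ex_markov => [||w]; rewrite ?exprn_gt0 ?sqr_ge0.
rewrite ler_pdivrMr ?exprn_gt0//; near: t; apply: deviation_cvg => //.
by rewrite mulr_gt0// exprn_gt0.
Unshelve. all: by end_near.
Qed.

End Deviation.

Theorem theorem2p2 (R : realType)
  (d' : measure_display) (T' : measurableType d') (Q : probability T' R)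
  (X : {RV Q >-> nat}) (hX : power_law2 X)
  (d : measure_display) (T : measurableType d) (P : probability T R)
  (Xs : nat -> {RV P >-> nat}) (C : nat -> nat -> {RV P >-> nat})
  (hmodel : parid (distribution Q X) Xs C)
  (k : nat) (hk : (1 <= k)%N) :
  cvg_in_probability P (prop_degree Xs C k) (b_lim R k).
Proof.
pose mu : probability nat R := distribution Q X.
have mu0 : mu [set 0%N] = 0%E := parid_pos hmodel.
have muE i : (0 < i)%N -> mu [set i] = (beta2 R * i%:R ^- 2)%:E.
  by move=> i0; exact: hX.
have beta0 : 0 <= beta2 R.
  have : (0 <= mu [set 1%N])%E by [].
  by rewrite muE// lee_fin expr1n invr1 mulr1.
apply: (prop_degree_cvg hmodel (c := 2)) => //.
- exact: (power_law_tail2 muE).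
- exact: (power_law_trunc_mean_unbounded mu0 muE).
- move=> j; rewrite /b_lim; apply: mulr_ge0.
    by apply: divr_ge0; rewrite ?mulr_ge0 ?addr_ge0.
  by apply: sumr_ge0 => i _; rewrite addr_ge0.
- by move=> j; rewrite muE//= b_lim_rec.
Qed.
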